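(* Fix integers $m_0\ge 1$ and $1\le m\le m_0$, and let $Z_n$ be the Zagreb index of the random network $U_n$. As $n\to\infty$, $$\frac{Z_n-(5m^2+m)n}{2m\sqrt{m+1}\,\sqrt n}\longrightarrow N(0,1)\quad\text{in distribution},$$ where $N(0,1)$ is the standard normal distribution.
   Context: The Zagreb index of a finite graph $G=(V,E)$ is $\sum_{v\in V}(\deg(v))^2$. The random network $U_n$ (with fixed integer parameters $m_0\ge1$, $1\le m\le m_0$) is defined as follows. At time $n=1$, $U_1$ is the complete graph on $m_0$ nodes (a single isolated node, with no self loop, if $m_0=1$). At each subsequent time $n\ge2$, a set of $m$ distinct nodes is chosen uniformly at random among all $m$-element subsets of the $n+m_0-2$ existing nodes (independently of the past given the current network), and a new node is added and joined to each of these $m$ nodes by one edge. Thus $U_n$ has $m_0+n-1$ nodes. $Z_n$ denotes the Zagreb index of $U_n$. *)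

(* Defs.v *)
From HB Require Import structures.
From mathcomp Require Import all_boot all_order all_algebra.
From mathcomp Require Import all_classical all_reals all_analysis.

Set Implicit Arguments.
Unset Strict Implicit.
Unset Printing Implicit Defensive.

Import Order.TTheory GRing.Theory Num.Theory.
Import numFieldNormedType.Exports.

Local Open Scope classical_set_scope.
Local Open Scope ring_scope.

(* A simple graph on the nodes 0, ..., N-1 is its set of edges, an edge being a
   two-element set of nodes. *)
Record sgraph (N : nat) := SGraph {
  edges : {set {set 'I_N}};
  edgesP : [forall e in edges, #|e| == 2]
}.

HB.instance Definition _ (N : nat) := [isSub for @edges N].
HB.instance Definition _ (N : nat) := [Finite of sgraph N by <:].

Definition degree (N : nat) (G : sgraph N) (v : 'I_N) : nat :=
  #|[set e in edges G | v \in e]%SET|.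

Definition zagreb (N : nat) (G : sgraph N) : nat :=
  (\sum_(v < N) degree G v ^ 2)%N.

Fact complete_edgesP (N : nat) :
  [forall e in [set e : {set 'I_N} | #|e| == 2]%SET, #|e| == 2].
Proof. by apply/forall_inP => e; rewrite inE. Qed.

Definition complete_graph (N : nat) : sgraph N := SGraph (complete_edgesP N).

(* The nodes of a graph on N nodes keep their numbers (through [lift ord_max]),
   and the new node is [ord_max], of number N. *)
Definition attach_edges (N : nat) (G : sgraph N) (A : {set 'I_N}) :
    {set {set 'I_N.+1}} :=
  ([set lift ord_max @: e | e : {set 'I_N} in edges G] :|:
   [set [set ord_max; lift ord_max v] | v in A])%SET.

Fact attach_edgesP (N : nat) (G : sgraph N) (A : {set 'I_N}) :
  [forall e in attach_edges G A, #|e| == 2].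
Proof.
apply/forall_inP => e; rewrite inE => /orP[] /imsetP[x xG ->].
  by rewrite card_imset ?(forall_inP (edgesP G))//; exact: lift_inj.
by rewrite cards2 neq_lift.
Qed.

Definition attach (N : nat) (G : sgraph N) (A : {set 'I_N}) : sgraph N.+1 :=
  SGraph (attach_edgesP G A).

(* Graphs and sets of nodes carry the discrete sigma-algebra. *)
Definition nodeset (N : nat) := {set 'I_N}.

HB.instance Definition _ (N : nat) := Finite.on (nodeset N).
HB.instance Definition _ (N : nat) := isPointed.Build (nodeset N) finset.set0.
HB.instance Definition _ (N : nat) :=
  @isMeasurable.Build default_measure_display (nodeset N) discrete_measurable
    discrete_measurable0 discrete_measurableC discrete_measurableU.

HB.instance Definition _ (N : nat) :=
  isPointed.Build (sgraph N) (complete_graph N).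
HB.instance Definition _ (N : nat) :=
  @isMeasurable.Build default_measure_display (sgraph N) discrete_measurable
    discrete_measurable0 discrete_measurableC discrete_measurableU.

(* The probability of A under the uniform law on the m-element subsets of
   {0, ..., N-1}. *)
Definition unif_subset (R : realType) (N m : nat) (A : nodeset N) : R :=
  (#|A| == m)%:R / 'C(N, m)%:R.

Section random_network.
Context (d : measure_display) (T : measurableType d) (R : realType).
Variables (P : probability T R) (m0 m : nat).

(* Time starts at 1: U n is the network at time n, on m0 + n - 1 nodes, and V n
   is the set of nodes chosen at time n >= 2 among the n + m0 - 2 existing ones.
   The values U 0, V 0 and V 1 are meaningless and unconstrained. *)
Variables (U : forall n, {RV P >-> sgraph (n.-1 + m0)})
          (V : forall n, {RV P >-> nodeset (n.-2 + m0)}).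

(* The event that the networks at times 1, ..., n are g 1, ..., g n. *)
Definition history (n : nat) (g : forall k, sgraph (k.-1 + m0)) : set T :=
  [set w | forall k, (0 < k <= n)%N -> U k w = g k].

(* The last field says that, conditionally on the networks at times 1, ..., n+1,
   the set chosen at time n+2 is uniform; the conditional probability is
   written in product form, so that null histories are allowed. *)
Record random_network : Prop := RandomNetwork {
  network_start : forall w, U 1 w = complete_graph m0;
  network_step : forall n w, U n.+2 w = attach (U n.+1 w) (V n.+2 w);
  network_choice : forall (n : nat) (g : forall k, sgraph (k.-1 + m0))
      (A : nodeset (n + m0)),
    P (V n.+2 @^-1` [set A] `&` history n.+1 g)
      = ((unif_subset R m A)%:E * P (history n.+1 g))%E
}.

End random_network.

Definition normalized_zagreb (R : realType) (m n N : nat) (G : sgraph N) : R :=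
  ((zagreb G)%:R - (5 * m ^ 2 + m)%:R * n%:R)
    / (2 * m%:R * Num.sqrt (m + 1)%:R * Num.sqrt n%:R).

Fact measurable_normalized_zagreb (R : realType) (m n N : nat) :
  measurable_fun [set: sgraph N] (@normalized_zagreb R m n N).
Proof. by []. Qed.

HB.instance Definition _ (R : realType) (m n N : nat) :=
  isMeasurableFun.Build _ _ _ _ (@normalized_zagreb R m n N)
    (@measurable_normalized_zagreb R m n N).

(* Convergence of the distribution functions at every continuity point of the
   limit distribution function. *)
Definition cvg_in_distribution (d : measure_display) (T : measurableType d)
    (R : realType) (P : probability T R) (X : nat -> {RV P >-> R})
    (mu : probability (measurableTypeR R) R) : Prop :=
  forall x : R, {for x, continuous (fun y : R => mu [set` `]-oo, y]])} ->
    cdf (X n) x @[n --> \oo] --> mu [set` `]-oo, x]].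

(* Main.v *)
(* Z_n is driven by the degree sum S of the chosen nodes:
   Z_{n+1} = Z_n + m^2 + m + 2 S. The total degree is deterministic, so up to O(1/n)
   the increment of Y_n = Z_n - (5m^2+m) n has conditional mean zero and, sampling m
   nodes without replacement, conditional variance 4m^2(m+1) + O((1 + |Y_n|)/n). A
   second-moment recursion gives E|Y_n| = O(sqrt n), and the sum of the cubes of the
   degrees has mean O(n), which bounds the third moments of the increments.
   Lindeberg's telescoping is run on the test function P(x + sqrt r N <= a), N
   standard normal: it is the normal distribution function at (a - x)/sqrt r, so it
   solves the heat equation in (r, x) explicitly and is itself a smoothed indicator.
   The k-th of the n steps costs O(1/(k sqrt n)), and these errors sum to o(1). *)
Require Import Defs.
From HB Require Import structures.
From mathcomp Require Import all_boot all_order all_algebra perm.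
From mathcomp Require Import all_classical all_reals all_analysis.
From mathcomp Require Import ring lra.
Import Order.TTheory GRing.Theory Num.Theory.
Import numFieldNormedType.Exports.
Local Open Scope classical_set_scope.
Local Open Scope ring_scope.

(** * The normal distribution function *)

(** The constants come from a self-consistency. The average degree tends to 2m, so m chosen nodes
    have mean degree sum about 2m^2 and the drift of Z_n is m^2 + m + 4m^2. Hence the average
    squared degree is about 5m^2 + m, and the degree sum of m nodes has variance about m(5m^2 + m) +
    m(m-1)(2m)^2 - (2m^2)^2 = m^2(m+1); the factor 2 in the increment makes it 4m^2(m+1). The
    obstacle is that the conditional variance is random: the average squared degree is Z_n divided
    by the number of nodes. Its deviation enters the telescoping only through its mean, which is why
    a bound on E|Y_n| suffices. A fixed variance e > 0 stays in the test function up to the last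
    step, so that its derivatives are bounded uniformly in n; the limit in n is taken for each such
    e. Means are finite sums over graphs and conditioning is a nested sum, so no conditional
    expectation is ever formed. *)

Definition std_pdf (R : realType) : R -> R := normal_pdf 0 1.

Definition std_cdf (R : realType) (x : R) : R := fine (normal_prob 0 1 `]-oo, x]).

Lemma is_derive_std_cdf (R : realType) (x : R) :
  is_derive x 1 (@std_cdf R) (std_pdf R x).
Proof.
have [] := @continuous_FTC1 R (std_pdf R) -oo%O x (x + 1) _ _ _ _.
- by rewrite ltrDl.
- apply: (integrableS _ _ (subsetT _)) => //.
  exact: integrable_normal_pdf.
- by rewrite ltNyr.
- exact: continuous_normal_pdf.
- by move=> df <-; rewrite derive1E; exact: derivableP.
Qed.

Lemma std_pdfE (R : realType) (x : R) :
  std_pdf R x = normal_peak 1 * expR (- (x ^+ 2 / 2)).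
Proof.
rewrite /std_pdf normal_pdfE ?oner_eq0// /normal_fun subr0 expr1n.
by rewrite mulNr.
Qed.

Lemma is_derive_std_pdf (R : realType) (x : R) :
  is_derive x 1 (std_pdf R) (- (x * std_pdf R x)).
Proof.
rewrite (_ : std_pdf R = fun x => normal_peak 1 * expR (- (x ^+ 2 / 2))); last first.
  by apply/funext => y; rewrite std_pdfE.
apply: is_derive_eq.
rewrite /GRing.scale/=; by field.
Qed.

Lemma expRN_le1 (R : realType) (u : R) : 0 <= u -> (1 + u) * expR (- u) <= 1.
Proof.
move=> u0; rewrite expRN ler_pdivrMr ?expR_gt0// mul1r.
exact: expR_ge1Dx.
Qed.

Lemma std_pdf_quartic (R : realType) :
  exists C : R, 0 < C /\ forall x : R, (1 + x ^+ 4) * std_pdf R x <= C.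
Proof.
pose p : R := normal_peak 1.
have p0 : 0 < p by rewrite normal_peak_gt0// oner_eq0.
(* 17 = 1 + 16: with u = x^2/4 the polynomial is 1 + 16 u^2 and the Gaussian factor is exp(-u)^2,
   while exp(-u) and u exp(-u) are both at most 1. *)
exists (p * 17); split; first by rewrite mulr_gt0.
move=> x; rewrite std_pdfE -/p mulrCA ler_pM2l//.
set u := x ^+ 2 / 4.
have u0 : 0 <= u by rewrite divr_ge0// sqr_ge0.
have -> : expR (- (x ^+ 2 / 2)) = expR (- u) ^+ 2.
  by rewrite -expRM_natl; congr expR; rewrite /u; field.
have -> : x ^+ 4 = 16 * u ^+ 2 by rewrite /u; field.
have := expRN_le1 _ _ u0; have := expR_gt0 (- u).
set e := expR _ => e0 h.
have ue0 : 0 <= u * e by rewrite mulr_ge0// ltW.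
have e1 : e ^+ 2 <= 1 by rewrite expr_le1 ?(ltW e0)//; lra.
have : (u * e) ^+ 2 <= 1 by rewrite expr_le1//; lra.
rewrite exprMn => h1; rewrite mulrDl mul1r -mulrA; lra.
Qed.

(** These factors make up the derivatives of Phi(x / sqrt r), up to order three in [x] and two in
    [r]. Their polynomials have degree at most 3, hence are dominated by 3 (1 + x^4). *)
Lemma std_pdf_bound (R : realType) : exists C : R, 0 < C /\ forall x : R,
  [/\ 0 <= std_pdf R x, std_pdf R x <= C, `|x * std_pdf R x| <= C,
      `|(x ^+ 2 - 1) * std_pdf R x| <= C &
      `|(x ^+ 2 - 1) * std_pdf R x * x| <= C].
Proof.
have [C [C0 hC]] := std_pdf_quartic R.
exists (3 * C); split; first by rewrite mulr_gt0.
move=> x; have f0 : 0 <= std_pdf R x by exact: normal_pdf_ge0.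
have := hC x; move: f0; set f := std_pdf R x => f0 h.
have key (c : R) : `|c| <= 3 * (1 + x ^+ 4) -> `|c * f| <= 3 * C.
  move=> hc; rewrite normrM (ger0_norm f0); apply: le_trans (_ : 3 * (1 + x ^+ 4) * f <= _).
    exact: ler_wpM2r.
  by rewrite -mulrA ler_pM2l.
have x2 := sqr_ge0 (x ^+ 2 - 1); have x3 := sqr_ge0 x.
have x1 := sqr_ge0 (x + 1); have x1' := sqr_ge0 (x - 1).
have x5 := sqr_ge0 (x ^+ 2 + x); have x5' := sqr_ge0 (x ^+ 2 - x).
split => //.
- by have := key 1; rewrite mul1r normr1 (ger0_norm f0); apply; nra.
- by apply: key; rewrite ler_norml; apply/andP; split; nra.
- by apply: key; rewrite ler_norml; apply/andP; split; nra.
- by rewrite mulrAC; apply: key; rewrite ler_norml; apply/andP; split; nra.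
Qed.

Lemma le_derive_lipschitz (R : realType) (f df : R -> R) (a b C : R) :
  (forall x, Num.min a b <= x <= Num.max a b -> is_derive x 1 f (df x)) ->
  (forall x, Num.min a b <= x <= Num.max a b -> `|df x| <= C) ->
  `|f b - f a| <= C * `|b - a|.
Proof.
wlog ab : a b / a <= b => [hw hd hC|].
  have [|/ltW] := leP a b => ab; first exact: hw.
  by rewrite distrC [X in _ * X]distrC; apply: hw => // x; rewrite minC maxC; [exact: hd|exact: hC].
rewrite (min_idPl ab) (max_idPr ab) => hd hC.
have hd' x : x \in `]a, b[ -> is_derive x 1 f (df x).
  by rewrite in_itv/= => /andP[? ?]; apply: hd; rewrite !ltW.
have [|c] := MVT_segment ab hd'.
  apply: derivable_within_continuous => x; rewrite in_itv/= => /hd h.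
  exact: ex_derive.
rewrite in_itv/= => /hC hc ->; rewrite normrM.
exact: ler_wpM2r.
Qed.

Lemma continuous_std_cdf (R : realType) : continuous (std_cdf R).
Proof.
move=> x; apply: differentiable_continuous; apply/derivable1_diffP.
by have d := is_derive_std_cdf R x; exact: ex_derive.
Qed.

Lemma std_cdf_ge0 (R : realType) (x : R) : 0 <= std_cdf R x.
Proof. exact: fine_ge0. Qed.

Lemma std_cdf_nondecreasing (R : realType) : {homo std_cdf R : x y / x <= y}.
Proof.
move=> x y xy; apply: fine_le; [exact: fin_num_measure|exact: fin_num_measure|].
by apply: le_measure; rewrite ?inE//; exact: subitvPr.
Qed.

Lemma std_cdf_le1 (R : realType) (x : R) : std_cdf R x <= 1.
Proof.
by rewrite -lee_fin fineK ?fin_num_measure//; exact: probability_le1.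
Qed.

(** Under the normal law the identity is a random variable whose [cdf] is the normal distribution
    function; the limits of a [cdf] at infinity thereby apply to [std_cdf]. *)
Definition real_id (R : realType) : measurableTypeR R -> R := idfun.

HB.instance Definition _ (R : realType) :=
  @isMeasurableFun.Build _ _ _ _ (real_id R) (@measurable_id _ _ setT).

Lemma std_cdf_cvgy (R : realType) : std_cdf R x @[x --> +oo] --> (1 : R).
Proof.
have h := @cvg_cdfy1 _ _ R (normal_prob 0 1) (real_id R).
exact: (fine_cvg h).
Qed.

Lemma std_cdf_cvgNy (R : realType) : std_cdf R x @[x --> -oo] --> (0 : R).
Proof.
have h := @cvg_cdfNy0 _ _ R (normal_prob 0 1) (real_id R).
exact: (fine_cvg h).
Qed.

(** * Taylor expansion in space and the heat equation in the variance *)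

Lemma ler_norm_between0 (R : realDomainType) (u v : R) :
  Num.min 0 u <= v <= Num.max 0 u -> `|v| <= `|u|.
Proof.
by have [u0|u0] := leP 0 u => /andP[v1 v2];
  [rewrite !ger0_norm|rewrite !ler0_norm ?lerN2// ltW].
Qed.

(** Three nested mean value inequalities, for [f2], for the first-order remainder of [f1], then for
    the second-order remainder of [f]. The constant is [C] instead of the sharp [C / 6]. *)
Lemma taylor_order2 (R : realType) (f f1 f2 f3 : R -> R) (C : R) :
  (forall x : R, is_derive x 1 f (f1 x)) ->
  (forall x : R, is_derive x 1 f1 (f2 x)) ->
  (forall x : R, is_derive x 1 f2 (f3 x)) ->
  (forall x, `|f3 x| <= C) ->
  forall z w, `|f (z + w) - f z - f1 z * w - f2 z * w ^+ 2 / 2| <= C * `|w| ^+ 3.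
Proof.
move=> d0 d1 d2 hC z w.
have C0 : 0 <= C by apply: le_trans (hC 0); exact: normr_ge0.
have shift (g dg : R -> R) (v : R) : (forall x : R, is_derive x 1 g (dg x)) ->
    is_derive v 1 (fun v => g (z + v)) (dg (z + v)).
  move=> dgE; rewrite -[dg _]mulr1.
  apply: (@is_derive1_comp _ g (fun v => z + v)).
  by apply: is_derive_eq; rewrite add0r mulr1.
have s2 v : `|v| <= `|w| -> `|f2 (z + v) - f2 z| <= C * `|w|.
  move=> vw; apply: le_trans (_ : C * `|v| <= _); last exact: ler_wpM2l.
  have := @le_derive_lipschitz R f2 f3 z (z + v) C.
  by rewrite [z + v - z]addrAC subrr add0r => h; apply: h => *; exact: hC.
have s1 v : `|v| <= `|w| -> `|f1 (z + v) - f1 z - f2 z * v| <= C * `|w| ^+ 2.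
  move=> vw.
  have := @le_derive_lipschitz R (fun v => f1 (z + v) - f2 z * v)
    (fun v => f2 (z + v) - f2 z) 0 v (C * `|w|).
  rewrite mulr0 subr0 addr0 subr0 => h.
  rewrite [X in `|X|](_ : _ = f1 (z + v) - f2 z * v - f1 z); last by ring.
  apply: le_trans (h _ _) _.
  - move=> t _; have := shift _ _ t d1 => ?.
    by apply: is_derive_eq; rewrite /GRing.scale/= mulr1; ring.
  - by move=> t /ler_norm_between0 tv; apply: s2; exact: le_trans vw.
  - by rewrite -mulrA ler_wpM2l// expr2 ler_wpM2l.
have := @le_derive_lipschitz R (fun v => f (z + v) - f1 z * v - f2 z * v ^+ 2 / 2)
  (fun v => f1 (z + v) - f1 z - f2 z * v) 0 w (C * `|w| ^+ 2).
rewrite expr0n/= !mulr0 mul0r !subr0 addr0 => h.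
rewrite [X in `|X|](_ : _ = f (z + w) - f1 z * w - f2 z * w ^+ 2 / 2 - f z); last by ring.
apply: le_trans (h _ _) _.
- move=> t _; have := shift _ _ t d0 => ?.
  by apply: is_derive_eq; rewrite /GRing.scale/= mulr1; field.
- by move=> t /ler_norm_between0 tv; exact: s1.
- by rewrite -mulrA -exprSr.
Qed.

Lemma is_derive_div_sqrt (R : realType) (x r : R) : 0 < r ->
  is_derive r 1 (fun r => x / Num.sqrt r) (- (x / Num.sqrt r / r / 2)).
Proof.
move=> r0; have s0 : Num.sqrt r != 0 by rewrite sqrtr_eq0 -ltNge.
have ds := is_derive1_sqrt r0.
have dv := is_deriveV s0.
apply: is_derive_eq.
rewrite /GRing.scale/= -[X in _ / X / 2](sqr_sqrtr (ltW r0)).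
set s := Num.sqrt r in s0 *; field.
by rewrite s0.
Qed.

Lemma is_derive_std_cdf_scaled (R : realType) (x r : R) : 0 < r ->
  is_derive r 1 (fun r => std_cdf R (x / Num.sqrt r))
    (- ((x / Num.sqrt r) * std_pdf R (x / Num.sqrt r) / r / 2)).
Proof.
move=> r0; have d1 := is_derive_div_sqrt _ x _ r0.
have d2 := is_derive_std_cdf R (x / Num.sqrt r).
rewrite [X in is_derive _ _ _ X](_ : _ =
  std_pdf R (x / Num.sqrt r) * - (x / Num.sqrt r / r / 2)); last by ring.
exact: (@is_derive1_comp _ (std_cdf R) (fun r => x / Num.sqrt r)).
Qed.

(** The second derivative in the variance bounds the error of freezing the first one during a step
    [h]; it is the source of the [h ^+ 2] in [std_cdf_heat_step]. *)
Lemma is_derive_std_cdf_scaled2 (R : realType) (x r : R) : 0 < r ->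
  let z := x / Num.sqrt r in
  is_derive r 1
    (fun r => - ((x / Num.sqrt r) * std_pdf R (x / Num.sqrt r) / r / 2))
    ((3 * (z * std_pdf R z) - (z ^+ 2) * (z * std_pdf R z)) / r ^+ 2 / 4).
Proof.
move=> r0 z; have d1 := is_derive_div_sqrt _ x _ r0.
have d2 := is_derive_std_pdf R z.
have d3 : is_derive r 1 (fun r => std_pdf R (x / Num.sqrt r)) _ :=
  @is_derive1_comp _ (std_pdf R) (fun r => x / Num.sqrt r) r _ _ d2 d1.
have r0' : r != 0 by rewrite gt_eqF.
have d4 := @is_deriveV R (fun r => r) r _ _ r0' _.
apply: is_derive_eq.
rewrite /GRing.scale/= -/z; set f := std_pdf R z; field.
by [].
Qed.

(* [std_cdf (x / sqrt r)] solves the heat equation [G_r = G_xx / 2], so removing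
   the variance [h] from [r] turns the second-order term [w ^+ 2] of a step [w]
   into [w ^+ 2 - h]. *)
Lemma std_cdf_heat_step (R : realType) (e : R) : 0 < e ->
  exists C : R, 0 < C /\ forall r h x : R, 0 <= h -> e <= r - h ->
  exists g1 g2 : R, [/\ `|g1| <= C, `|g2| <= C & forall w,
   `|std_cdf R ((x + w) / Num.sqrt (r - h)) - std_cdf R (x / Num.sqrt r)
      - g1 * w - g2 * (w ^+ 2 - h)| <= C * (`|w| ^+ 3 + h ^+ 2)].
Proof.
move=> e0.
have [B [B0 hB]] := std_pdf_bound R.
pose q := (Num.sqrt e)^-1.
have q0 : 0 < q by rewrite invr_gt0 sqrtr_gt0.
(* Each derivative in [x] costs a factor 1 / sqrt r <= q and each derivative in [r] two of them: the
   powers 1 to 4 serve [g1], [g2], the cubic Taylor remainder and the second derivative in [r]. *)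
pose C := B * q + B * q ^+ 2 + B * q ^+ 3 + B * q ^+ 4.
exists C; split; first by rewrite /C !addr_gt0// mulr_gt0// exprn_gt0.
move=> r h x h0 er.
set r' := r - h in er *.
have r'0 : 0 < r' by exact: lt_le_trans er.
set s := (Num.sqrt r')^-1.
have s0 : 0 < s by rewrite invr_gt0 sqrtr_gt0.
have sq : s <= q.
  by rewrite /s /q lef_pV2 ?posrE ?sqrtr_gt0//; exact: ler_wsqrtr.
have sk k : s ^+ k <= q ^+ k by rewrite lerXn2r// ?nnegrE ltW.
have s2 : s ^+ 2 = r'^-1 by rewrite /s exprVn sqr_sqrtr// ltW.
set z := x * s.
have [f0 f1 f2 f3 f4] := hB z.
have qk k : 0 <= B * q ^+ k by rewrite mulr_ge0// ?exprn_ge0 ?ltW.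
have B1 : B * q <= C.
  by rewrite /C; have := qk 2; have := qk 3; have := qk 4; lra.
have B2 : B * q ^+ 2 <= C.
  by rewrite /C; have := qk 1; have := qk 3; have := qk 4; rewrite expr1; lra.
have B3 : B * q ^+ 3 <= C.
  by rewrite /C; have := qk 1; have := qk 2; have := qk 4; rewrite expr1; lra.
have B4 : B * q ^+ 4 <= C.
  by rewrite /C; have := qk 1; have := qk 3; have := qk 2; rewrite expr1; lra.
(* The first derivative and half the second derivative in [x] of the test function, at the variance
   [r'] left after the step. *)
exists (std_pdf R z * s), (- (z * std_pdf R z) * s ^+ 2 / 2).
have E1 : `|std_pdf R z * s| <= C.
  apply: le_trans B1; rewrite normrM (gtr0_norm s0) (ger0_norm f0).
  by apply: ler_pM => //; exact: ltW.
have E2 : `|- (z * std_pdf R z) * s ^+ 2 / 2| <= C.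
  have sn : 0 <= s ^+ 2 / 2 by rewrite divr_ge0// sqr_ge0.
  apply: le_trans B2; rewrite -mulrA normrM normrN (ger0_norm sn).
  apply: ler_pM => //; apply: le_trans (sk 2%N).
  by rewrite ler_pdivrMr// ler_peMr ?sqr_ge0// ler1n.
split => // w.
have T := @taylor_order2 R (std_cdf R) (std_pdf R) (fun x => - (x * std_pdf R x))
  (fun x => (x ^+ 2 - 1) * std_pdf R x) B _ _ _ _ z (w * s).
have {}T : `|std_cdf R (z + w * s) - std_cdf R z - std_pdf R z * (w * s)
  - - (z * std_pdf R z) * (w * s) ^+ 2 / 2| <= B * `|w * s| ^+ 3.
  apply: T => y.
  - exact: is_derive_std_cdf.
  - exact: is_derive_std_pdf.
  - have d2 := is_derive_std_pdf R y.
    by apply: is_derive_eq; rewrite /GRing.scale/=; ring.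
  - by have [] := hB y.
pose D r := std_cdf R (x / Num.sqrt r).
pose E r := - ((x / Num.sqrt r) * std_pdf R (x / Num.sqrt r) / r / 2).
have r'r : r' <= r by rewrite /r' lerBlDr lerDl.
have LE rho : r' <= rho <= r -> `|E rho - E r'| <= B * q ^+ 4 * h.
  move=> /andP[h1 h2].
  have := @le_derive_lipschitz R E (fun r => let z := x / Num.sqrt r in
    (3 * (z * std_pdf R z) - (z ^+ 2) * (z * std_pdf R z)) / r ^+ 2 / 4) r' rho
    (B * q ^+ 4).
  rewrite (min_idPl h1) (max_idPr h1) => H.
  apply: le_trans (H _ _) _.
  - move=> t /andP[t1 t2]; apply: is_derive_std_cdf_scaled2.
    exact: lt_le_trans t1.
  - move=> t /andP[t1 t2] /=; set zt := x / _.
    have [p0 p1 p2 p3 p4] := hB zt.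
    have t0 : 0 < t by exact: lt_le_trans t1.
    have st : t^-1 <= q ^+ 2.
      rewrite /q exprVn (sqr_sqrtr (ltW e0)) lef_pV2 ?posrE//.
      exact: le_trans t1.
    have st2 : (t ^+ 2)^-1 <= q ^+ 4.
      by rewrite -exprVn -[4%N]/(2 * 2)%N exprM lerXn2r// ?nnegrE ?sqr_ge0// invr_ge0 ltW.
    rewrite -mulrA normrM; apply: le_trans (_ : 3 * B * (q ^+ 4 / 4) <= _).
      apply: ler_pM => //.
        rewrite [X in `|X|](_ : _ = 2 * (zt * std_pdf R zt)
          - (zt ^+ 2 - 1) * std_pdf R zt * zt); last by ring.
        move: p2 p4; rewrite !ler_norml => /andP[? ?] /andP[? ?].
        by apply/andP; split; lra.
      by rewrite ger0_norm ?divr_ge0// ?invr_ge0 ?sqr_ge0// ler_pM2r.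
    by have := qk 4; lra.
  - apply: ler_wpM2l; first exact: qk.
    by rewrite ger0_norm ?subr_ge0// lerBlDl /r' subrK.
have DD : `|D r - D r' - E r' * h| <= B * q ^+ 4 * h * h.
  have := @le_derive_lipschitz R (fun t => D t - E r' * t) (fun t => E t - E r') r' r
    (B * q ^+ 4 * h).
  rewrite (min_idPl r'r) (max_idPr r'r) => H.
  have -> : D r - D r' - E r' * h = D r - E r' * r - (D r' - E r' * r') by rewrite /r'; ring.
  apply: le_trans (H _ _) _ => //.
  - move=> t /andP[t1 t2].
    have t0 : 0 < t by exact: lt_le_trans t1.
    have dd := is_derive_std_cdf_scaled _ x _ t0.
    by apply: is_derive_eq; rewrite /GRing.scale/= mulr1.
  - by rewrite /r' opprB addrCA subrr addr0 (ger0_norm h0).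
have -> : (x + w) / Num.sqrt r' = z + w * s by rewrite mulrDl.
(* The heat equation: the derivative in [r] at [r'] equals the coefficient of [w ^+ 2], so one [g2]
   serves both [w ^+ 2] and [h]. *)
have Er : E r' = - (z * std_pdf R z) * s ^+ 2 / 2.
  by rewrite /E -/s -/z s2; ring.
rewrite -Er; rewrite -/(D r).
have Dr : D r' = std_cdf R z by [].
rewrite [X in `|X|](_ : _ = (std_cdf R (z + w * s) - std_cdf R z - std_pdf R z * (w * s)
  - - (z * std_pdf R z) * (w * s) ^+ 2 / 2) - (D r - D r' - E r' * h)); last first.
  by rewrite Dr Er; field.
apply: le_trans (ler_normB _ _) _.
rewrite mulrDr; apply: lerD.
  apply: le_trans T _; rewrite normrM exprMn (gtr0_norm s0).
  rewrite mulrCA mulrC ler_wpM2r ?exprn_ge0//; apply: le_trans B3.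
  by rewrite ler_pM2l.
apply: le_trans DD _; rewrite -mulrA -expr2 ler_wpM2r ?sqr_ge0//.
Qed.

(** * Uniform random subsets *)

Definition subset_mean (R : realType) (N m : nat) (f : nodeset N -> R) : R :=
  \sum_(A : nodeset N) unif_subset R m A * f A.

Lemma unif_subset_ge0 (R : realType) (N m : nat) (A : nodeset N) :
  0 <= unif_subset R m A.
Proof. by rewrite /unif_subset divr_ge0. Qed.

Lemma unif_subset_neq (R : realType) (N m : nat) (A : nodeset N) :
  #|A| != m -> unif_subset R m A = 0.
Proof. by rewrite /unif_subset => /negbTE ->; rewrite mul0r. Qed.

Lemma subset_mean_cst (R : realType) (N m : nat) (c : R) : (m <= N)%N ->
  subset_mean R N m (fun=> c) = c.
Proof.
move=> mN; rewrite /subset_mean -mulr_suml -mulr_suml -natr_sum.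
rewrite (_ : (\sum_A _)%N = 'C(N, m)).
  by rewrite divff ?mul1r// pnatr_eq0 -lt0n bin_gt0.
rewrite -[N in RHS]card_ord -card_draws -sum1dep_card [RHS]big_mkcond/=.
by apply: eq_bigr => A _; case: eqP.
Qed.

Lemma subset_meanD (R : realType) (N m : nat) (f g : nodeset N -> R) :
  subset_mean R N m (fun A => f A + g A) = subset_mean R N m f + subset_mean R N m g.
Proof. by rewrite -big_split; apply: eq_bigr => A _; rewrite mulrDr. Qed.

Lemma subset_meanZ (R : realType) (N m : nat) (c : R) (f : nodeset N -> R) :
  subset_mean R N m (fun A => c * f A) = c * subset_mean R N m f.
Proof. by rewrite /subset_mean mulr_sumr; apply: eq_bigr => A _; rewrite mulrCA. Qed.

Lemma le_subset_mean (R : realType) (N m : nat) (f g : nodeset N -> R) :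
  (forall A : nodeset N, #|A| = m -> f A <= g A) ->
  subset_mean R N m f <= subset_mean R N m g.
Proof.
move=> fg; apply: ler_sum => A _; have [/fg h|/unif_subset_neq ->] := eqVneq #|A| m.
  by rewrite ler_wpM2l ?unif_subset_ge0.
by rewrite !mul0r.
Qed.

Lemma eq_subset_mean (R : realType) (N m : nat) (f g : nodeset N -> R) :
  (forall A : nodeset N, #|A| = m -> f A = g A) ->
  subset_mean R N m f = subset_mean R N m g.
Proof.
by move=> fg; apply/eqP; rewrite eq_le !le_subset_mean// => A /fg ->.
Qed.

Lemma subset_mean_sum (R : realType) (N m : nat) (I : finType)
    (f : I -> nodeset N -> R) :
  subset_mean R N m (fun A => \sum_i f i A) = \sum_i subset_mean R N m (f i).
Proof. by rewrite exchange_big; apply: eq_bigr => A _; rewrite mulr_sumr. Qed.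

Lemma ler_norm_subset_mean (R : realType) (N m : nat) (f : nodeset N -> R) :
  `|subset_mean R N m f| <= subset_mean R N m (fun A => `|f A|).
Proof.
apply: le_trans (ler_norm_sum _ _ _) _; apply: ler_sum => A _.
by rewrite normrM (ger0_norm (unif_subset_ge0 _ _ _ _)).
Qed.

(** The weight depends on the cardinality alone, which a permutation preserves. This exchangeability
    replaces binomial counting in the inclusion probabilities. *)
Lemma subset_mean_perm (R : realType) (N m : nat) (s : {perm 'I_N})
    (f : nodeset N -> R) :
  subset_mean R N m (fun A => f (s @: A)%SET) = subset_mean R N m f.
Proof.
rewrite /subset_mean [RHS](reindex_inj (imset_inj (@perm_inj _ s))).
by apply: eq_bigr => A _; rewrite /unif_subset card_imset//; exact: perm_inj.
Qed.

Section inclusion_probabilities.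
Variables (R : realType) (N m : nat).
Hypotheses (N0 : (0 < N)%N) (mN : (m <= N)%N).

(** The probability that both nodes are chosen. By exchangeability it has one value on the diagonal
    and one off it; these follow by summing over [w], as the indicators of a chosen set add up to
    [m]. *)
Let q (v w : 'I_N) : R :=
  subset_mean R N m (fun A => (v \in A)%:R * (w \in A)%:R).

Let q_perm (s : {perm 'I_N}) v w : q (s v) (s w) = q v w.
Proof.
rewrite /q -(subset_mean_perm R N m s).
by apply: eq_subset_mean => A _; rewrite !mem_imset//; exact: perm_inj.
Qed.

Let sum_in (A : nodeset N) : \sum_v (v \in A)%:R = #|A|%:R :> R.
Proof. by rewrite -natr_sum -big_mkcond/= sum1_card. Qed.

Let q_diag v : q v v = m%:R / N%:R.
Proof.
have q_cst w : q w w = q v v by rewrite -(tpermL v w) q_perm.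
have : \sum_(w < N) q w w = m%:R.
  rewrite -subset_mean_sum -[RHS](subset_mean_cst R N m _ mN).
  apply: eq_subset_mean => A <-; rewrite -sum_in.
  by apply: eq_bigr => w _; case: (w \in A); rewrite ?mulr1 ?mulr0.
under eq_bigr do rewrite q_cst.
by rewrite sumr_const card_ord -[_ *+ N]mulr_natr => <-; rewrite mulfK// pnatr_eq0 -lt0n.
Qed.

Let q_offdiag v w : v != w ->
  q v w = m%:R * (m%:R - 1) / (N%:R * (N%:R - 1)).
Proof.
move=> vw.
have q_cst u : v != u -> q v u = q v w.
  move=> vu; rewrite -(q_perm (tperm u w) v u) tpermL tpermD//; first by rewrite eq_sym.
  by rewrite eq_sym.
have N1 : (1 < N)%N.
  by rewrite -[N]card_ord; apply/card_gt1P; exists v, w.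
have : \sum_(u < N) q v u = m%:R * q v v.
  rewrite -subset_mean_sum -subset_meanZ.
  apply: eq_subset_mean => A Am; rewrite -mulr_sumr sum_in Am.
  by case: (v \in A); rewrite ?mulr1 ?mul1r ?mul0r ?mulr0.
rewrite (bigD1 v)//= (eq_bigr (fun=> q v w)); last first.
  by move=> u uv; rewrite q_cst// eq_sym.
rewrite sumr_const (_ : #|_| = N.-1); last first.
  by rewrite cardC1 card_ord.
rewrite -[_ *+ N.-1]mulr_natr q_diag -subn1 natrB// => h.
have n0 : (N%:R : R) != 0 by rewrite pnatr_eq0 gtn_eqF.
have n1 : (N%:R - 1 : R) != 0 by rewrite subr_eq0 (eqr_nat R N 1) gtn_eqF.
have {}h : q v w * (N%:R - 1) = m%:R * (m%:R / N%:R) - m%:R / N%:R by rewrite -h; ring.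
by apply: (mulIf n1); rewrite h; field; rewrite n0 n1.
Qed.

Let sum_inE (x : 'I_N -> R) (A : nodeset N) :
  \sum_(v in A) x v = \sum_v x v * (v \in A)%:R.
Proof.
by rewrite big_mkcond; apply: eq_bigr => v _; case: ifP; rewrite ?mulr1 ?mulr0.
Qed.

Lemma subset_mean_sum1 (x : 'I_N -> R) :
  subset_mean R N m (fun A => \sum_(v in A) x v) = m%:R / N%:R * \sum_v x v.
Proof.
under [LHS]eq_subset_mean do rewrite sum_inE.
rewrite subset_mean_sum mulr_sumr; apply: eq_bigr => v _.
rewrite subset_meanZ mulrC -(q_diag v); congr (_ * _).
by apply: eq_subset_mean => A _; case: (v \in A); rewrite ?mulr1 ?mulr0.
Qed.

(** The diagonal and the off-diagonal part of the expanded square carry the two values of [q]. For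
    [N = 1] the second fraction is a division by zero, thus 0, and the bracket vanishes too. *)
Lemma subset_mean_sum2 (x : 'I_N -> R) :
  subset_mean R N m (fun A => (\sum_(v in A) x v) ^+ 2) =
  m%:R / N%:R * \sum_v x v ^+ 2 +
  m%:R * (m%:R - 1) / (N%:R * (N%:R - 1)) *
    ((\sum_v x v) ^+ 2 - \sum_v x v ^+ 2).
Proof.
set p := _ / N%:R; set r := _ / (_ * _).
transitivity (\sum_v \sum_w x v * x w * q v w).
  transitivity (subset_mean R N m
      (fun A => \sum_v \sum_w x v * x w * ((v \in A)%:R * (w \in A)%:R))).
    apply: eq_subset_mean => A _; rewrite sum_inE expr2 mulr_suml.
    apply: eq_bigr => v _; rewrite mulr_sumr; apply: eq_bigr => w _.
    by rewrite mulrACA.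
  rewrite subset_mean_sum; apply: eq_bigr => v _.
  rewrite subset_mean_sum; apply: eq_bigr => w _.
  by rewrite subset_meanZ.
transitivity (\sum_v (x v ^+ 2 * (p - r) + x v * (\sum_w x w) * r)).
  apply: eq_bigr => v _; rewrite (bigD1 v)//= [\sum_w x w](bigD1 v)//= q_diag.
  rewrite (eq_bigr (fun w => x v * x w * r)); last first.
    by move=> w wv; rewrite q_offdiag// eq_sym.
  rewrite -mulr_suml -mulr_sumr -/p; ring.
rewrite big_split/= -!mulr_suml; ring.
Qed.

End inclusion_probabilities.

(** * Degrees after an attachment *)

(** New edges contain [ord_max] and lifted ones never do, so the edges at an old node split
    disjointly into lifts and at most one new edge, present exactly when [v] is in [A]. *)
Lemma degree_attach_old (N : nat) (G : sgraph N) (A : {set 'I_N}) (v : 'I_N) :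
  degree (attach G A) (lift ord_max v) = (degree G v + (v \in A))%N.
Proof.
rewrite /degree /attach/=.
have -> : [set e in attach_edges G A | lift ord_max v \in e]%SET =
    ([set lift ord_max @: e | e : {set 'I_N} in [set e in edges G | v \in e]] :|:
     [set [set ord_max; lift ord_max w] | w in A :&: [set v]])%SET.
  apply/setP => e; rewrite !inE; apply/andP/orP => [[/orP[]]|[]].
  - move=> /imsetP[f fG ->]; rewrite mem_imset; last exact: lift_inj.
    by move=> vf; left; apply: imset_f; rewrite inE fG.
  - move=> /imsetP[w wA ->]; rewrite !inE [_ == ord_max]eq_sym (negbTE (neq_lift _ _))/=.
    move=> /eqP/lift_inj ->; right; apply: imset_f.
    by rewrite !inE wA eqxx.
  - move=> /imsetP[f]; rewrite inE => /andP[fG vf] ->; split.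
      by rewrite imset_f.
    by rewrite imset_f.
  - move=> /imsetP[w]; rewrite !inE => /andP[wA /eqP wv] ->; split.
      by apply/orP; right; apply: imset_f.
    by rewrite wv !inE eqxx orbT.
rewrite cardsU [X in (_ - #|pred_of_set X|)%N](_ : _ = finset.set0)%SET; last first.
  apply/setP => e; rewrite !inE; apply/negP => /andP[] /imsetP[f _ ->] /imsetP[w _ h].
  have : ord_max \in (lift ord_max @: f)%SET by rewrite h !inE eqxx.
  by move=> /imsetP[u _ /eqP]; rewrite (negbTE (neq_lift _ _)).
rewrite cards0 subn0 card_imset; last exact/imset_inj/lift_inj.
congr addn; case: (boolP (v \in A)) => vA.
  rewrite (_ : _ :&: _ = [set v])%SET ?imset_set1 ?cards1//.
  by apply/setP => w; rewrite !inE; case: eqP => [->|]; rewrite ?vA ?andbF.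
rewrite (_ : _ :&: _ = finset.set0)%SET ?imset0 ?cards0//.
by apply/setP => w; rewrite !inE; case: eqP => [->|]; rewrite ?(negbTE vA) ?andbF.
Qed.

Lemma degree_attach_new (N : nat) (G : sgraph N) (A : {set 'I_N}) :
  degree (attach G A) ord_max = #|A|.
Proof.
rewrite /degree /attach/=.
have -> : [set e in attach_edges G A | ord_max \in e]%SET =
    [set [set ord_max; lift ord_max w] | w in A]%SET.
  apply/setP => e; rewrite !inE; apply/andP/idP => [[/orP[]//]|h].
    by move=> /imsetP[f _ ->] /imsetP[u _ /eqP]; rewrite (negbTE (neq_lift _ _)).
  by split; [rewrite h orbT|move: h => /imsetP[w _ ->]; rewrite !inE eqxx].
rewrite card_imset// => u w /setP /(_ (lift ord_max u)).
rewrite !inE eqxx orbT eq_sym (negbTE (neq_lift _ _))/= => /esym/eqP.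
exact: lift_inj.
Qed.

(** Order 1 is twice the number of edges, order 2 the Zagreb index; order 3 controls the third
    moments of the increments. *)
Definition degree_moment (R : realType) (k N : nat) (G : sgraph N) : R :=
  \sum_(v < N) (degree G v)%:R ^+ k.

Lemma zagrebE (R : realType) (N : nat) (G : sgraph N) :
  (zagreb G)%:R = degree_moment R 2 N G.
Proof. by rewrite natr_sum; apply: eq_bigr => v _; rewrite natrX. Qed.

Lemma degree_moment_attach (R : realType) (k N : nat) (G : sgraph N)
    (A : {set 'I_N}) :
  degree_moment R k _ (attach G A) =
    \sum_(v < N) ((degree G v)%:R + (v \in A)%:R) ^+ k + #|A|%:R ^+ k.
Proof.
rewrite /degree_moment big_ord_recr/= degree_attach_new; congr (_ + _).
apply: eq_bigr => v _; rewrite -natrD -degree_attach_old.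
by congr ((degree _ _)%:R ^+ _); apply: val_inj; exact: esym (lift_max v).
Qed.

Section attach_moments.
Variables (R : realType) (N : nat) (G : sgraph N) (A : {set 'I_N}).

(** An indicator [b] satisfies b^2 = b, so (x + b)^k is affine in [b]: the change of a power sum of
    the old degrees is a sum over the chosen nodes. *)
Let sum_split (f g : 'I_N -> R) (h : 'I_N -> R) :
  (forall v, f v = g v + h v * (v \in A)%:R) ->
  \sum_v f v = \sum_v g v + \sum_(v in A) h v.
Proof.
move=> e; rewrite [\sum_(v in A) _]big_mkcond -big_split/=.
by apply: eq_bigr => v _; rewrite e; case: ifP; rewrite ?mulr1 ?mulr0.
Qed.

Lemma degree_moment1_attach :
  degree_moment R 1 _ (attach G A) = degree_moment R 1 _ G + 2 * #|A|%:R.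
Proof.
rewrite degree_moment_attach (sum_split _ (fun v => (degree G v)%:R ^+ 1) (fun=> 1)); last first.
  by move=> v; rewrite !expr1 mul1r.
by rewrite sumr_const expr1 /degree_moment; ring.
Qed.

Lemma degree_moment2_attach :
  degree_moment R 2 _ (attach G A) =
    degree_moment R 2 _ G + 2 * (\sum_(v in A) (degree G v)%:R) + #|A|%:R
      + #|A|%:R ^+ 2.
Proof.
rewrite degree_moment_attach (sum_split _ (fun v => (degree G v)%:R ^+ 2)
  (fun v => 2 * (degree G v)%:R + 1)); last first.
  by move=> v; case: (v \in A) => /=; ring.
by rewrite big_split/= -mulr_sumr sumr_const /degree_moment; ring.
Qed.

Lemma degree_moment3_attach :
  degree_moment R 3 _ (attach G A) =
    degree_moment R 3 _ G + \sum_(v in A) (3 * (degree G v)%:R ^+ 2 +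
      3 * (degree G v)%:R + 1) + #|A|%:R ^+ 3.
Proof.
rewrite degree_moment_attach (sum_split _ (fun v => (degree G v)%:R ^+ 3)
  (fun v => 3 * (degree G v)%:R ^+ 2 + 3 * (degree G v)%:R + 1))//.
by move=> v; case: (v \in A) => /=; ring.
Qed.

End attach_moments.

(** * The law of the network *)

(* The mean of [f] over the network at time [i.+1]. *)
Fixpoint network_mean (R : realType) (m0 m i : nat) :
    (sgraph (i + m0) -> R) -> R :=
  match i return (sgraph (i + m0) -> R) -> R with
  | 0 => fun f => f (complete_graph m0)
  | j.+1 => fun f => network_mean R m0 m j
      (fun g => subset_mean R (j + m0) m (fun A => f (attach g A)))
  end.

Definition total_degree (R : realType) (m0 m i : nat) : R :=
  degree_moment R 1 m0 (complete_graph m0) + 2 * m%:R * i%:R.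

(* Almost surely the total degree is deterministic: other graphs have weight zero. *)
Lemma le_network_mean (R : realType) (m0 m i : nat) (f h : sgraph (i + m0) -> R) :
  (forall g, degree_moment R 1 _ g = total_degree R m0 m i -> f g <= h g) ->
  network_mean R m0 m i f <= network_mean R m0 m i h.
Proof.
elim: i f h => [|i IH] f h fh /=.
  by apply: fh; rewrite /total_degree mulr0 addr0.
apply: IH => g gd; apply: le_subset_mean => A Am; apply: fh.
rewrite degree_moment1_attach gd Am /total_degree -[i.+1%:R]natr1; ring.
Qed.

Lemma eq_network_mean (R : realType) (m0 m i : nat) (f h : sgraph (i + m0) -> R) :
  (forall g, degree_moment R 1 _ g = total_degree R m0 m i -> f g = h g) ->
  network_mean R m0 m i f = network_mean R m0 m i h.
Proof.
by move=> fh; apply/eqP; rewrite eq_le !le_network_mean// => g /fh ->.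
Qed.

Lemma network_mean_cst (R : realType) (m0 m i : nat) (c : R) : (m <= m0)%N ->
  network_mean R m0 m i (fun=> c) = c.
Proof.
move=> mm0; elim: i => [//|i IH] /=.
under eq_network_mean do rewrite subset_mean_cst ?(leq_trans mm0) ?leq_addl//.
exact: IH.
Qed.

Lemma network_meanD (R : realType) (m0 m i : nat) (f h : sgraph (i + m0) -> R) :
  network_mean R m0 m i (fun g => f g + h g) =
  network_mean R m0 m i f + network_mean R m0 m i h.
Proof.
elim: i f h => [//|i IH] f h /=; rewrite -IH.
by under eq_network_mean do rewrite subset_meanD.
Qed.

Lemma network_meanZ (R : realType) (m0 m i : nat) (c : R) (f : sgraph (i + m0) -> R) :
  network_mean R m0 m i (fun g => c * f g) = c * network_mean R m0 m i f.
Proof.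
elim: i f => [//|i IH] f /=; rewrite -IH.
by under eq_network_mean do rewrite subset_meanZ.
Qed.

Lemma network_meanB (R : realType) (m0 m i : nat) (f h : sgraph (i + m0) -> R) :
  network_mean R m0 m i (fun g => f g - h g) =
  network_mean R m0 m i f - network_mean R m0 m i h.
Proof.
rewrite network_meanD -[in RHS]mulN1r -network_meanZ; congr (_ + _).
by apply: eq_network_mean => g _; rewrite mulN1r.
Qed.

Lemma ler_norm_network_mean (R : realType) (m0 m i : nat) (f : sgraph (i + m0) -> R) :
  `|network_mean R m0 m i f| <= network_mean R m0 m i (fun g => `|f g|).
Proof.
rewrite ler_norml; apply/andP; split; last first.
  by apply: le_network_mean => g _; exact: ler_norm.
rewrite -mulN1r -network_meanZ; apply: le_network_mean => g _.
by rewrite mulN1r lerNl ler_normr lexx orbT.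
Qed.

(** * From the probability space to finite sums *)

Lemma measure_finite_partition (d : measure_display) (T : measurableType d)
    (R : realType) (P : probability T R) (F : finType) (X : T -> F) (E : set T) :
  (forall h, measurable (X @^-1` [set h])) -> measurable E ->
  P E = (\sum_h P (E `&` X @^-1` [set h]))%E.
Proof.
move=> mX mE.
have {1}-> : E = \bigcup_(h in [set: F]) (E `&` X @^-1` [set h]).
  by rewrite -setI_bigcupr -preimage_bigcup bigcup_imset1 image_id preimage_setT setIT.
rewrite measure_fin_bigcup//.
- rewrite (fsbigE (index_enum F)) ?index_enum_uniq//=.
    by apply: eq_bigl => h; rewrite in_setT.
  by move=> h _; rewrite mem_index_enum.
- exact: finite_finset.
- by move=> h h' _ _ [w [[_ /= <-] [_ /= <-]]].
- by move=> h _; exact: measurableI.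
Qed.

Section law.
Context (d : measure_display) (T : measurableType d) (R : realType).
Variables (P : probability T R) (m0 m : nat).
Variables (U : forall n, {RV P >-> sgraph (n.-1 + m0)})
          (V : forall n, {RV P >-> nodeset (n.-2 + m0)}).
Hypothesis UV : random_network m U V.

Let mU n g : measurable (U n @^-1` [set g]).
Proof. by rewrite -[X in measurable X]setTI; exact: measurable_funP. Qed.

Let mV n A : measurable (V n @^-1` [set A]).
Proof. by rewrite -[X in measurable X]setTI; exact: measurable_funP. Qed.

(** The history with the times up to [j] forgotten: [j = 0] gives the full history up to time
    [n.+1], [j = n] the event on the current network alone. *)
Let late (j n : nat) (g : forall k, sgraph (k.-1 + m0)) : set T :=
  [set w | forall k, (j < k <= n.+1)%N -> U k w = g k].

Let mlate j n g : measurable (late j n g).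
Proof.
rewrite (_ : late j n g = \bigcap_(k in [set k | (j < k <= n.+1)%N]) U k @^-1` [set g k]).
  by apply: bigcap_measurableType => k _; exact: mU.
by apply/seteqP; split => w wl k; exact: wl.
Qed.

(* The times [1, ..., j] are summed out of the history one after the other. *)
Let choice_late (j n : nat) (g : forall k, sgraph (k.-1 + m0)) (A : nodeset (n + m0)) :
  (j <= n)%N ->
  P (V n.+2 @^-1` [set A] `&` late j n g) =
    ((unif_subset R m A)%:E * P (late j n g))%E.
Proof.
elim: j g => [|j IH] g jn; first exact: network_choice.
(* Fixing the network at time [j.+1] to be [h] gives back an event with one time less forgotten, for
   [g] altered at [j.+1]; the induction hypothesis then applies to each [h]. *)
have lateE : forall h, late j.+1 n g `&` U j.+1 @^-1` [set h] =
    late j n (@eqtype.dfwith _ (fun k => sgraph (k.-1 + m0)) g j.+1 h).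
  move=> h; apply/seteqP; split => w.
    move=> [wl wh] k /andP[jk kn].
    have [ejk|jk'] := eqVneq j.+1 k.
      by subst k; rewrite eqtype.dfwith_in.
    by rewrite eqtype.dfwith_out// wl// kn andbT ltn_neqAle jk'.
  move=> wl; split.
    move=> k /andP[jk kn]; rewrite wl ?(ltnW jk)// eqtype.dfwith_out//.
    by rewrite neq_ltn jk.
  by rewrite /= wl ?ltnSn ?ltnS ?(ltnW jn)// eqtype.dfwith_in.
rewrite (measure_finite_partition _ _ _ _ _ (U j.+1) _ (mU _)); last first.
  exact: measurableI.
rewrite [in RHS](measure_finite_partition _ _ _ _ _ (U j.+1) _ (mU _)) //.
rewrite ge0_sume_distrr//; apply: eq_bigr => h _.
by rewrite -setIA lateE IH// ltnW.
Qed.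

(** The Markov form of [network_choice]: with all earlier times summed out, the uniform choice holds
    given the current network. [g0] merely fills the other times. *)
Lemma network_transition (n : nat) (g : sgraph (n + m0)) (A : nodeset (n + m0)) :
  P (V n.+2 @^-1` [set A] `&` U n.+1 @^-1` [set g]) =
    ((unif_subset R m A)%:E * P (U n.+1 @^-1` [set g]))%E.
Proof.
pose g0 : forall k, sgraph (k.-1 + m0) := fun k => complete_graph _.
have <- : late n n (@eqtype.dfwith _ (fun k => sgraph (k.-1 + m0)) g0 n.+1 g) = U n.+1 @^-1` [set g].
  apply/seteqP; split => w.
    by move=> wl; rewrite /= wl ?eqtype.dfwith_in// !ltnSn.
  move=> wg k /andP[nk kn]; have kE : k = n.+1 by apply/eqP; rewrite eqn_leq kn.
  by subst k; rewrite eqtype.dfwith_in.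
exact: choice_late.
Qed.

(** By induction on time: the pair of the current graph and the chosen set has a product weight by
    [network_transition], and this pair determines the next graph through [attach], as in the
    recursion of [network_mean]. *)
Lemma sum_law (i : nat) (f : sgraph (i + m0) -> R) :
  \sum_g fine (P (U i.+1 @^-1` [set g])) * f g = network_mean R m0 m i f.
Proof.
elim: i f => [|i IH] f.
  rewrite (bigD1 (complete_graph m0))//= big1 ?addr0.
    rewrite (_ : _ @^-1` _ = setT) ?probability_setT ?mul1r//.
    by apply/seteqP; split => // w _; exact: (network_start UV).
  move=> g gk; rewrite (_ : _ @^-1` _ = set0) ?measure0 ?mul0r//.
  apply/seteqP; split => // w /=; rewrite (network_start UV) => gE.
  by rewrite -gE eqxx in gk.
rewrite /= -IH.
have lawE g' : fine (P (U i.+2 @^-1` [set g'])) = \sum_g \sum_A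
    (attach g A == g')%:R * (unif_subset R m A * fine (P (U i.+1 @^-1` [set g]))).
  rewrite (measure_finite_partition _ _ _ _ _ (U i.+1) _ (mU _))//.
  rewrite -sum_fine; last by move=> g _; apply: fin_num_measure; apply: measurableI; exact: mU.
  apply: eq_bigr => g _.
  rewrite (measure_finite_partition _ _ _ _ _ (V i.+2) _ (mV _)); last first.
    by apply: measurableI; exact: mU.
  rewrite -sum_fine; last first.
    move=> A _; apply: fin_num_measure; apply: measurableI; last exact: mV.
    by apply: measurableI; exact: mU.
  apply: eq_bigr => A _; case: eqVneq => [<-|gA].
    rewrite mul1r -[X in X * _]/(fine (unif_subset R m A)%:E) -fineM ?fin_num_measure//.
    rewrite -network_transition; congr (fine (P _)).
    apply/seteqP; split => w; first by move=> [[_ h1] h2].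
    by move=> [/= h1 h2]; rewrite (network_step UV) h1 h2.
  rewrite mul0r (_ : _ `&` _ = set0) ?measure0//.
  apply/seteqP; split => // w [[/=]]; rewrite (network_step UV) => h1 h2 h3.
  by move: gA; rewrite -h1 h2 h3 eqxx.
under eq_bigr do rewrite lawE mulr_suml.
rewrite exchange_big; apply: eq_bigr => g _ /=.
under eq_bigr do rewrite mulr_suml.
rewrite exchange_big mulr_sumr; apply: eq_bigr => A _ /=.
rewrite (bigD1 (attach g A))//= eqxx big1 ?addr0; first by rewrite mul1r; ring.
by move=> g' /negbTE; rewrite eq_sym => ->; rewrite !mul0r.
Qed.

(** The estimates below are all about [network_mean]; this identity carries them back to the
    probability space. *)
Lemma law_network_mean (i : nat) (B : pred (sgraph (i + m0))) :
  P [set w | B (U i.+1 w)] = (network_mean R m0 m i (fun g => (B g)%:R))%:E.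
Proof.
have mB : measurable [set w | B (U i.+1 w)].
  rewrite (_ : [set w | _] = U i.+1 @^-1` [set g | B g])//.
  by rewrite -[X in measurable X]setTI; exact: measurable_funP.
rewrite -sum_law (measure_finite_partition _ _ _ _ _ (U i.+1) _ (mU _))//.
rewrite -sumEFin; apply: eq_bigr => g _; case: (boolP (B g)) => Bg.
  rewrite mulr1 fineK ?fin_num_measure//; congr (P _).
  by apply/seteqP; split => w; [move=> []|move=> /= ->].
rewrite mulr0 (_ : _ `&` _ = set0) ?measure0//.
by apply/seteqP; split => // w [/= + gE]; rewrite gE; apply/negP.
Qed.

End law.

(** * Moments of the Zagreb index *)

Lemma ler_normM_le (R : numDomainType) (x y a b : R) :
  `|x| <= a -> `|y| <= b -> `|x * y| <= a * b.
Proof. by move=> xa yb; rewrite normrM; exact: ler_pM. Qed.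

Lemma ler_normD_le (R : numDomainType) (x y a b : R) :
  `|x| <= a -> `|y| <= b -> `|x + y| <= a + b.
Proof. by move=> xa yb; apply: le_trans (ler_normD _ _) _; exact: lerD. Qed.

Lemma linear_growth (R : realDomainType) (a : nat -> R) (C : R) :
  (forall i, a i.+1 <= a i + C) ->
  forall i, a i <= (`|a 0%N| + `|C|) * i.+1%:R.
Proof.
move=> aS; elim=> [|i IH].
  by rewrite mulr1; apply: le_trans (ler_norm _) _; rewrite lerDl.
apply: le_trans (aS i) _; rewrite -[i.+2%:R]natr1 mulrDr mulr1 lerD//.
by apply: le_trans (ler_norm _) _; rewrite lerDr.
Qed.

(** Comparison with the largest term. Convexity would give the square of the cardinality as factor,
    but here the cardinality is the constant [m]. *)
Lemma sum_cube_le (R : realDomainType) (I : finType) (A : {set I}) (x : I -> R) :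
  (forall i, 0 <= x i) ->
  (\sum_(i in A) x i) ^+ 3 <= #|A|%:R ^+ 3 * \sum_(i in A) x i ^+ 3.
Proof.
move=> x0; have [->|/set0Pn[i0 i0A]] := eqVneq A finset.set0.
  by rewrite !big_set0 expr0n/= mulr0.
have [i iA xi] := @arg_maxP _ _ _ i0 (mem A) x i0A.
apply: le_trans (_ : (#|A|%:R * x i) ^+ 3 <= _).
  rewrite lerXn2r ?nnegrE ?sumr_ge0 ?mulr_ge0//.
  rewrite mulr_natl -sumr_const; apply: ler_sum => j jA; exact: xi.
rewrite exprMn ler_wpM2l ?exprn_ge0// (bigD1 i)//= lerDl.
by apply: sumr_ge0 => j _; rewrite exprn_ge0.
Qed.

Section moments.
Variables (R : realType) (m0 m : nat).
Hypotheses (m_gt0 : (0 < m)%N) (m_le : (m <= m0)%N).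

Local Notation M := (m%:R : R).
Local Notation size i := ((i + m0)%:R : R).
Local Notation mom k g := (degree_moment R k _ g).

(** Index [i] stands for time n = i + 1, so this is Z_n - (5m^2 + m) n. *)
Definition centered_zagreb (i : nat) (g : sgraph (i + m0)) : R :=
  mom 2 g - (5 * M ^+ 2 + M) * i.+1%:R.

(** What is left of m^2 + m + 2S after removing the drift 5m^2 + m. The term 4m^2 is twice the
    limiting mean of S, that of m nodes of average degree 2m. *)
Definition zagreb_increment (i : nat) (g : sgraph (i + m0)) (A : {set 'I_(i + m0)}) : R :=
  2 * (\sum_(v in A) (degree g v)%:R) - 4 * M ^+ 2.

Local Notation Y := centered_zagreb.
Local Notation eta := zagreb_increment.
Local Notation typical i g := (mom 1 g = total_degree R m0 m i).

Lemma centered_zagreb_attach (i : nat) (g : sgraph (i + m0)) (A : {set 'I_(i + m0)}) :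
  #|A| = m -> Y i.+1 (attach g A) = Y i g + eta i g A.
Proof.
move=> Am; rewrite /centered_zagreb /zagreb_increment degree_moment2_attach Am.
by rewrite -[i.+2%:R]natr1; ring.
Qed.

Let m0_gt0 : (0 < m0)%N. Proof. exact: leq_trans m_le. Qed.
Let size_ge i : i.+1%:R <= size i.
Proof. by rewrite ler_nat -addn1 leq_add2l. Qed.
Let size_gt0 i : 0 < size i.
Proof. exact: lt_le_trans (size_ge i). Qed.
Let sizeN0 i : (0 < i + m0)%N. Proof. by rewrite addn_gt0 m0_gt0 orbT. Qed.
Let m_le_size i : (m <= i + m0)%N. Proof. exact/(leq_trans m_le)/leq_addl. Qed.
Let M0 : 0 < M. Proof. by rewrite ltr0n. Qed.
Let M1 : 1 <= M. Proof. by rewrite ler1n. Qed.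
Let Mge0 : 0 <= M. Proof. exact: ltW. Qed.
Let M1ge0 : 0 <= M - 1. Proof. by rewrite subr_ge0. Qed.
Let momE (i k : nat) (g : sgraph (i + m0)) :
  \sum_v (degree g v)%:R ^+ k = mom k g.
Proof. by []. Qed.
Let mom1E (i : nat) (g : sgraph (i + m0)) : \sum_v (degree g v)%:R = mom 1 g.
Proof. by apply: eq_bigr => v _; rewrite expr1. Qed.
Let mom_ge0 (i k : nat) (g : sgraph (i + m0)) : 0 <= mom k g.
Proof. by apply: sumr_ge0 => v _; rewrite exprn_ge0. Qed.

(** The constant gap between the total degree and 2m times the number of nodes, inherited from the
    complete graph at the start. *)
Let kappa : R := mom 1 (complete_graph m0) - 2 * M * m0%:R.

Let typicalE (i : nat) (g : sgraph (i + m0)) : typical i g ->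
  mom 1 g = 2 * M * size i + kappa.
Proof. by move=> ->; rewrite /total_degree /kappa natrD; ring. Qed.

Let mean_sumE (i : nat) (g : sgraph (i + m0)) : typical i g ->
  subset_mean R _ m (fun A => \sum_(v in A) (degree g v)%:R) =
  2 * M ^+ 2 + M * kappa * (size i)^-1.
Proof.
move=> gd; rewrite subset_mean_sum1// mom1E typicalE//.
have := lt0r_neq0 (size_gt0 i); move: (size i) => n n0.
by field.
Qed.

Let inv_size_le i : (size i)^-1 <= i.+1%:R^-1.
Proof. by rewrite lef_pV2 ?posrE. Qed.

Let norm_inv_size_le i : `|(size i)^-1| <= i.+1%:R^-1.
Proof. by rewrite gtr0_norm ?invr_gt0. Qed.

Let inv_size_le1 i : (size i)^-1 <= 1.
Proof. by apply: le_trans (inv_size_le i) _; rewrite invf_le1// ler1n. Qed.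

Lemma mean_zagreb_increment : exists C : R, 0 < C /\
  forall (i : nat) (g : sgraph (i + m0)), typical i g ->
  `|subset_mean R _ m (eta i g)| <= C / i.+1%:R.
Proof.
exists (1 + 2 * M * `|kappa|); split.
  by rewrite ltr_pwDl// !mulr_ge0.
move=> i g gd.
(* An exact value: the drift comes from [kappa] alone. As [kappa] may vanish, the constant above
   contains an additional 1. *)
have -> : subset_mean R _ m (eta i g) = 2 * M * kappa / size i.
  rewrite /zagreb_increment subset_meanD subset_meanZ mean_sumE//.
  by rewrite subset_mean_cst//; ring.
apply: ler_normM_le.
  rewrite !normrM ger0_norm// (ger0_norm (ltW M0)); lra.
exact: norm_inv_size_le.
Qed.

Lemma mean_zagreb_increment_sqr : exists C : R, 0 < C /\
  forall (i : nat) (g : sgraph (i + m0)), typical i g ->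
  `|subset_mean R _ m (fun A => eta i g A ^+ 2) - 4 * M ^+ 2 * (M + 1)|
    <= C * (1 + `|Y i g|) / i.+1%:R.
Proof.
(* With u = 1/size, the whole error is exactly [X * u], with [X] as posed below. [c0] and [c1]
   collect the contributions of [kappa] and of the offset between [size] and time; the second power
   sum of the degrees is rewritten through [Y], which makes [X] affine in [Y]. *)
pose a := 5 * M ^+ 2 + M.
pose c0 := - 4 * M * a * (m0%:R - 1) + 16 * M ^+ 2 * (M - 1) * kappa - 16 * M ^+ 3 * kappa.
pose c1 := 4 * M * (M - 1) * kappa ^+ 2.
pose B := M * (M - 1) + 2 * M ^+ 2.
pose C := 4 * M + `|c0| + `|c1| + 4 * (2 * M ^+ 2) * (2 * M + `|kappa|) ^+ 2
  + 4 * B * (1 + `|a| * (1 + `|m0%:R - 1|)).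
have B0 : 0 <= B.
  by rewrite /B addr_ge0 ?mulr_ge0 ?sqr_ge0.
exists C; split.
  rewrite /C; do 4!(apply: ltr_wpDr; first by rewrite ?mulr_ge0 ?sqr_ge0 ?addr_ge0 ?mulr_ge0).
  by rewrite mulr_gt0.
move=> i g gd.
set u := (size i)^-1.
have u0 : 0 < u by rewrite invr_gt0.
have u1 : u <= 1 by exact: inv_size_le1.
have nu : size i = u^-1 by rewrite invrK.
(* [t] measures the error made by replacing [size * (size - 1)] with [size ^+ 2]; for
   [size = 1] the division by zero is harmless, as then [m = 1]. *)
have [t [tB qE]] : exists t : R, `|t| <= 2 * M ^+ 2 /\
    M * (M - 1) / (size i * (size i - 1)) = u ^+ 2 * (M * (M - 1)) + u ^+ 3 * t.
  have [m1|m2] := leqP m 1.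
    have -> : M = 1 by rewrite (_ : m = 1%N)//; apply/eqP; rewrite eqn_leq m1.
    by exists 0; rewrite normr0 subrr mulr0 mul0r !mulr0 addr0.
  have n2 : 2 <= size i by rewrite ler_nat; exact: leq_trans (m_le_size i).
  have n1 : 0 < size i - 1 by rewrite subr_gt0; apply: lt_le_trans n2; rewrite ltr1n.
  exists (M * (M - 1) * (size i / (size i - 1))); split; last first.
    move: (lt0r_neq0 (size_gt0 i)) (lt0r_neq0 n1); rewrite /u.
    by move: (size i) => n ? ?; field; apply/andP.
  have k2 : size i / (size i - 1) <= 2 by rewrite ler_pdivrMr//; lra.
  rewrite ger0_norm; last by rewrite !mulr_ge0// invr_ge0 ltW.
  rewrite mulrC; apply: ler_pM => //; first by rewrite divr_ge0// ltW.
    by rewrite mulr_ge0.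
  by rewrite expr2 ler_wpM2l// gerBl.
set y := Y i g.
have mom2E : mom 2 g = y + a * (u^-1 - (m0%:R - 1)).
  rewrite /y /centered_zagreb -/a -nu natrD -natr1; ring.
pose w := 2 * M + kappa * u.
pose E2 := M * (M - 1) + u * t.
pose X := 4 * M * y + c0 + c1 * u + 4 * t * w ^+ 2
  - 4 * E2 * (u * y + a * (1 - u * (m0%:R - 1))).
have -> : subset_mean R _ m (fun A => eta i g A ^+ 2) - 4 * M ^+ 2 * (M + 1) = X * u.
  transitivity (4 * subset_mean R _ m (fun A => (\sum_(v in A) (degree g v)%:R) ^+ 2)
    + (- 16 * M ^+ 2) * subset_mean R _ m (fun A => \sum_(v in A) (degree g v)%:R)
    + 16 * M ^+ 4 - 4 * M ^+ 2 * (M + 1)).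
    congr (_ - _); rewrite -[16 * M ^+ 4](subset_mean_cst R (i + m0) m _ (m_le_size i)).
    rewrite -!subset_meanZ -!subset_meanD; apply: eq_subset_mean => A _.
    rewrite /zagreb_increment; ring.
  rewrite mean_sumE// subset_mean_sum2// momE mom1E qE typicalE// mom2E -/u nu.
  rewrite /X /E2 /w /c0 /c1 /a; field; rewrite gt_eqF//.
apply: ler_normM_le; last exact: norm_inv_size_le.
have uu : `|u| <= 1 by rewrite ger0_norm// ltW.
have E2B : `|E2| <= B.
  apply: ler_normD_le; first by rewrite ger0_norm// mulr_ge0.
  by rewrite -[leRHS]mul1r; exact: ler_normM_le.
have wB : `|w| <= 2 * M + `|kappa|.
  apply: ler_normD_le; first by rewrite ger0_norm// mulr_ge0.
  by rewrite -[leRHS]mulr1; exact: ler_normM_le.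
have y0 : 0 <= `|y| by [].
have b1 : `|4 * M * y| <= 4 * M * `|y|.
  by apply: ler_normM_le => //; rewrite ger0_norm// mulr_ge0.
have b2 : `|c1 * u| <= `|c1| by rewrite -[leRHS]mulr1; exact: ler_normM_le.
have b3 : `|4 * t * w ^+ 2| <= 4 * (2 * M ^+ 2) * (2 * M + `|kappa|) ^+ 2.
  apply: ler_normM_le; last by rewrite normrX lerXn2r ?nnegrE.
  by apply: ler_normM_le => //; rewrite ger0_norm.
have b4 : `|1 - u * (m0%:R - 1)| <= 1 + `|m0%:R - 1|.
  apply: ler_normD_le; first by rewrite normr1.
  by rewrite normrN -[leRHS]mul1r; exact: ler_normM_le.
have b5 : `|u * y + a * (1 - u * (m0%:R - 1))| <= `|y| + `|a| * (1 + `|m0%:R - 1|).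
  apply: ler_normD_le; last exact: ler_normM_le.
  by rewrite -[leRHS]mul1r; exact: ler_normM_le.
have b6 : `|4 * E2 * (u * y + a * (1 - u * (m0%:R - 1)))| <=
    4 * B * (`|y| + `|a| * (1 + `|m0%:R - 1|)).
  by apply: ler_normM_le => //; apply: ler_normM_le => //; rewrite ger0_norm.
have := ler_normB (4 * M * y + c0 + c1 * u + 4 * t * w ^+ 2)
  (4 * E2 * (u * y + a * (1 - u * (m0%:R - 1)))).
rewrite -/X => bX; apply: le_trans bX _.
have bX : `|4 * M * y + c0 + c1 * u + 4 * t * w ^+ 2| <=
    4 * M * `|y| + `|c0| + `|c1| + 4 * (2 * M ^+ 2) * (2 * M + `|kappa|) ^+ 2.
  by do 3!apply: ler_normD_le => //.
have n1 : 0 <= `|c0| * `|y| by rewrite mulr_ge0.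
have n2 : 0 <= `|c1| * `|y| by rewrite mulr_ge0.
have n3 : 0 <= 4 * (2 * M ^+ 2) * (2 * M + `|kappa|) ^+ 2 * `|y|.
  by rewrite !mulr_ge0 ?sqr_ge0.
have n5 : 0 <= 4 * B by rewrite mulr_ge0.
have n6 : 0 <= `|a| * (1 + `|m0%:R - 1|) by rewrite mulr_ge0// addr_ge0.
have n4 : 0 <= 4 * B * (`|a| * (1 + `|m0%:R - 1|)) * `|y| by rewrite mulr_ge0// mulr_ge0.
apply: le_trans (lerD bX b6) _; rewrite /C.
have expand (p q r s b c z : R) : 0 <= p -> 0 <= q * z -> 0 <= r * z ->
    0 <= s * z -> 0 <= b -> 0 <= b * c * z ->
    p * z + q + r + s + b * (z + c) <= (p + q + r + s + b * (1 + c)) * (1 + z).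
  by move=> *; lra.
by apply: expand => //; rewrite mulr_ge0.
Qed.

Lemma mean_zagreb_increment_cube : exists C : R, 0 < C /\
  forall (i : nat) (g : sgraph (i + m0)),
  subset_mean R _ m (fun A => `|eta i g A| ^+ 3) <= C * (1 + mom 3 g / i.+1%:R).
Proof.
(* From (a + b)^3 <= 4 (a^3 + b^3) with a = 2S and b = 4m^2: 32 = 4 * 2^3 and 256 = 4 * 4^3. In [C1]
   the factor [M ^+ 3] is that of [sum_cube_le], and the last [M] comes from the inclusion
   probability. *)
pose C1 := 32 * M ^+ 3 * M.
pose C2 := 256 * M ^+ 6.
have C10 : 0 < C1 by rewrite !mulr_gt0// exprn_gt0.
have C20 : 0 < C2 by rewrite !mulr_gt0// exprn_gt0.
exists (C1 + C2); split; first exact: addr_gt0.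
move=> i g.
apply: le_trans (_ : subset_mean R _ m (fun A =>
  32 * M ^+ 3 * (\sum_(v in A) (degree g v)%:R ^+ 3) + C2) <= _).
  apply: le_subset_mean => A Am.
  pose S : R := \sum_(v in A) (degree g v)%:R.
  have S0 : 0 <= S by exact: sumr_ge0.
  have S3 : S ^+ 3 <= M ^+ 3 * \sum_(v in A) (degree g v)%:R ^+ 3.
    by rewrite -Am; exact: sum_cube_le.
  apply: le_trans (_ : 32 * S ^+ 3 + C2 <= _); last first.
    by rewrite lerD2r -mulrA ler_pM2l.
  apply: le_trans (_ : (2 * S + 4 * M ^+ 2) ^+ 3 <= _).
    rewrite lerXn2r ?nnegrE ?addr_ge0 ?mulr_ge0 ?sqr_ge0//.
    apply: le_trans (ler_normB _ _) _.
    by rewrite !ger0_norm ?mulr_ge0 ?sqr_ge0.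
  have q0 : 0 <= M ^+ 2 by exact: sqr_ge0.
  rewrite /C2 (_ : M ^+ 6 = (M ^+ 2) ^+ 3); last by rewrite -exprM.
  set q := M ^+ 2 in q0 *.
  have : 0 <= (2 * S + 4 * q) * (2 * S - 4 * q) ^+ 2.
    by rewrite mulr_ge0 ?sqr_ge0// addr_ge0// mulr_ge0.
  nra.
rewrite subset_meanD subset_meanZ subset_mean_cst// subset_mean_sum1// momE.
have T0 := mom_ge0 i 3 g.
have : 32 * M ^+ 3 * (M / size i * mom 3 g) <= C1 * (mom 3 g / i.+1%:R).
  rewrite [leLHS](_ : _ = C1 * (mom 3 g * (size i)^-1)); last by rewrite /C1; ring.
  by rewrite ler_pM2l// ler_wpM2l.
have : 0 <= mom 3 g / i.+1%:R by rewrite divr_ge0.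
set z := mom 3 g / _; nra.
Qed.
End moments.

(** * Growth of the mean moments *)

Section mean_bounds.
Variables (R : realType) (m0 m : nat).
Hypotheses (m_gt0 : (0 < m)%N) (m_le : (m <= m0)%N).

Local Notation M := (m%:R : R).
Local Notation size i := ((i + m0)%:R : R).
Local Notation mom k g := (degree_moment R k _ g).
Local Notation Y := (centered_zagreb R m0 m).
Local Notation eta := (zagreb_increment R m0 m).
Local Notation E := (network_mean R m0 m).
Local Notation typical i g := (mom 1 g = total_degree R m0 m i).

Let m_le_size i : (m <= i + m0)%N. Proof. exact/(leq_trans m_le)/leq_addl. Qed.
Let M0 : 0 <= M. Proof. by []. Qed.
Let inv_le1 i : (i.+1%:R : R)^-1 <= 1.
Proof. by rewrite invf_le1// ler1n. Qed.
Let inv_ge0 i : 0 <= (i.+1%:R : R)^-1.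
Proof. by rewrite invr_ge0. Qed.
Let a : R := 5 * M ^+ 2 + M.
Let a_ge0 : 0 <= a. Proof. by rewrite addr_ge0// mulr_ge0// sqr_ge0. Qed.
Let mom_ge0 (i k : nat) (g : sgraph (i + m0)) : 0 <= mom k g.
Proof. by apply: sumr_ge0 => v _; rewrite exprn_ge0. Qed.

Let E_le (i : nat) (f h : sgraph (i + m0) -> R) (C : R) :
  (forall g, typical i g -> f g <= h g + C) -> E i f <= E i h + C.
Proof.
move=> fh; rewrite -[X in _ + X](network_mean_cst R m0 m i C m_le) -network_meanD.
exact: le_network_mean.
Qed.

Let mom2E i (g : sgraph (i + m0)) : mom 2 g = Y i g + a * i.+1%:R.
Proof. by rewrite /centered_zagreb -/a subrK. Qed.

Lemma mean_zagreb_le : exists C : R, 0 < C /\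
  forall i, E i (fun g => mom 2 g) <= C * i.+1%:R.
Proof.
have [C [C0 hC]] := mean_zagreb_increment R m0 m m_gt0 m_le.
exists (`|E 0 (fun g => mom 2 g)| + `|a + C|); split.
  by rewrite ltr_wpDl// normr_gt0 gt_eqF// ltr_wpDl.
apply: linear_growth => i /=; apply: E_le => g gt.
have /ler_normlP[_ h] := hC i g gt.
apply: le_trans (_ : mom 2 g + a + subset_mean R _ m (eta i g) <= _); last first.
  rewrite -addrA lerD2l lerD2l; apply: le_trans h _.
  by rewrite ler_pdivrMr// ler_peMr ?(ltW C0)// ler1n.
rewrite le_eqVlt; apply/orP; left; apply/eqP.
rewrite -[mom 2 g + a](subset_mean_cst R (i + m0) m _ (m_le_size i)) -subset_meanD.
apply: eq_subset_mean => A Am.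
apply: etrans (mom2E i.+1 (attach g A)) _.
by rewrite mom2E centered_zagreb_attach// -[i.+2%:R]natr1; ring.
Qed.

(** A step adds on average at most 6m/size times the Zagreb index, plus a constant. By
    [mean_zagreb_le] this amount is bounded in mean. *)
Lemma mean_degree_cube_le : exists C : R, 0 < C /\
  forall i, E i (fun g => mom 3 g) <= C * i.+1%:R.
Proof.
have [C [C0 hC]] := mean_zagreb_le.
pose D := 6 * M * C + M + M ^+ 3.
have D0 : 0 <= D by rewrite !addr_ge0 ?exprn_ge0// !mulr_ge0// ltW.
exists (`|E 0 (fun g => mom 3 g)| + `|D| + 1); split.
  by rewrite ltr_pwDr// addr_ge0.
move=> i; apply: le_trans (_ : (`|E 0 (fun g => mom 3 g)| + `|D|) * i.+1%:R <= _); last first.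
  by rewrite ler_wpM2r// lerDl.
move: i; apply: linear_growth => i /=.
pose h (g : sgraph (i + m0)) := mom 3 g + 6 * M / i.+1%:R * mom 2 g.
apply: le_trans (_ : E i h + (M + M ^+ 3) <= _).
  apply: E_le => g gt.
  apply: le_trans (_ : subset_mean R _ m (fun A => (mom 3 g + M ^+ 3)
      + \sum_(v in A) (6 * (degree g v)%:R ^+ 2 + 1)) <= _).
    apply: le_subset_mean => A Am; rewrite degree_moment3_attach Am.
    rewrite -!addrA lerD2l addrC lerD2l; apply: ler_sum => v _.
    set x : R := (degree g v)%:R.
    (* Degrees are integers, so 3x^2 + 3x is at most 6x^2. *)
    have : x <= x ^+ 2.
      by rewrite /x -natrX ler_nat; case: (degree g v) => // n; rewrite -[X in (X <= _)%N]expn1 leq_pexp2l.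
    lra.
  rewrite subset_meanD subset_mean_cst// subset_mean_sum1//; last first.
    by apply: leq_trans (m_le_size i).
  rewrite big_split/= -mulr_sumr sumr_const card_ord /h.
  rewrite -[\sum_v _]/(mom 2 g).
  have s0 : 0 < size i by rewrite ltr0n; exact: leq_trans (m_le_size i).
  have -> : M / size i * (6 * mom 2 g + 1 *+ (i + m0)) =
      6 * M * ((size i)^-1 * mom 2 g) + M.
    by move: (lt0r_neq0 s0); move: (size i) => n n0; field.
  have -> : 6 * M / i.+1%:R * mom 2 g = 6 * M * (i.+1%:R^-1 * mom 2 g) by rewrite !mulrA.
  have : 6 * M * ((size i)^-1 * mom 2 g) <= 6 * M * (i.+1%:R^-1 * mom 2 g).
    rewrite ler_wpM2l ?mulr_ge0//; apply: ler_wpM2r; first exact: mom_ge0.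
    rewrite lef_pV2 ?posrE// ler_nat -addn1 leq_add2l.
    exact: leq_trans m_le.
  move: (6 * M * ((size i)^-1 * mom 2 g)) (6 * M * (i.+1%:R^-1 * mom 2 g)) => p q; lra.
rewrite /h network_meanD network_meanZ -addrA lerD2l /D.
rewrite -[leRHS]addrA lerD2r.
apply: le_trans (_ : 6 * M / i.+1%:R * (C * i.+1%:R) <= _).
  by rewrite ler_wpM2l ?divr_ge0 ?mulr_ge0.
rewrite le_eqVlt; apply/orP; left; apply/eqP.
by have := pnatr_eq0 R i.+1; move: (i.+1%:R : R) => n /negbT n0; field.
Qed.

(** Both the drift and the variance error contribute a multiple of |Y|/(i+1). The crude bound |Y| <=
    Z + a(i+1) already has mean O(i), so the mean square grows by a bounded amount per step and no
    Gronwall argument is needed. *)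
Lemma mean_centered_sqr_le : exists C : R, 0 < C /\
  forall i, E i (fun g => Y i g ^+ 2) <= C * i.+1%:R.
Proof.
have [C1 [C10 h1]] := mean_zagreb_le.
have [C2 [C20 h2]] := mean_zagreb_increment R m0 m m_gt0 m_le.
have [C3 [C30 h3]] := mean_zagreb_increment_sqr R m0 m m_gt0 m_le.
pose c2 := 4 * M ^+ 2 * (M + 1).
pose D := (2 * C2 + C3) * (C1 + a) + c2 + C3.
exists (`|E 0 (fun g => Y 0 g ^+ 2)| + `|D| + 1); split.
  by rewrite ltr_pwDr// addr_ge0.
move=> i; apply: le_trans (_ : (`|E 0 (fun g => Y 0 g ^+ 2)| + `|D|) * i.+1%:R <= _); last first.
  by rewrite ler_wpM2r// lerDl.
move: i; apply: (linear_growth _ (fun i => E i (fun g => Y i g ^+ 2))) => i /=.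
pose k : R := i.+1%:R^-1.
have k0 : 0 <= k by exact: inv_ge0.
have k1 : k <= 1 by exact: inv_le1.
pose h (g : sgraph (i + m0)) := Y i g ^+ 2 + (2 * C2 + C3) * k * mom 2 g.
apply: le_trans (_ : E i h + ((2 * C2 + C3) * a + c2 + C3) <= _).
  apply: E_le => g gt.
  apply: le_trans (_ : Y i g ^+ 2 + 2 * Y i g * subset_mean R _ m (eta i g)
      + subset_mean R _ m (fun A => eta i g A ^+ 2) <= _).
    rewrite le_eqVlt; apply/orP; left; apply/eqP.
    rewrite -(subset_mean_cst R (i + m0) m (Y i g ^+ 2) (m_le_size i)).
    rewrite -subset_meanZ -!subset_meanD; apply: eq_subset_mean => A Am.
    by rewrite centered_zagreb_attach//; ring.
  have := h2 i g gt; have /ler_normlP[_] := h3 i g gt.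
  have yq : `|Y i g| <= mom 2 g + a * i.+1%:R.
    rewrite /centered_zagreb -/a; apply: le_trans (ler_normB _ _) _.
    by rewrite !ger0_norm ?mulr_ge0.
  have ky : k * `|Y i g| <= k * mom 2 g + a.
    apply: le_trans (ler_wpM2l k0 yq) _; rewrite mulrDr lerD2l /k mulrCA mulVf ?mulr1//.
  rewrite -/c2 -/k; set e1 := subset_mean _ _ _ (eta i g); set e2 := subset_mean _ _ _ (fun=> _).
  move=> he2 he1.
  have : 2 * Y i g * e1 <= 2 * C2 * (k * `|Y i g|).
    apply: le_trans (ler_norm _) _; rewrite !normrM normr_nat -!mulrA ler_pM2l//.
    by rewrite [leLHS]mulrC mulrA ler_wpM2r.
  have : 2 * C2 * (k * `|Y i g|) <= 2 * C2 * (k * mom 2 g + a).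
    by rewrite ler_wpM2l// mulr_ge0// ltW.
  have : C3 * (k * `|Y i g|) <= C3 * (k * mom 2 g + a) by rewrite ler_wpM2l// ltW.
  have : C3 * k <= C3 by rewrite ler_piMr// ltW.
  rewrite /h; move: he2; lra.
rewrite /h network_meanD network_meanZ -addrA lerD2l /D.
have := ler_wpM2l k0 (h1 i); rewrite /k mulrCA mulVf// mulr1 -/k => h1'.
have : (2 * C2 + C3) * (k * E i (fun g => mom 2 g)) <= (2 * C2 + C3) * C1.
  by rewrite ler_wpM2l// addr_ge0 ?mulr_ge0// ltW.
rewrite mulrA; lra.
Qed.

Lemma mean_centered_abs_le : exists C : R, 0 < C /\
  forall i, E i (fun g => `|Y i g|) <= C * Num.sqrt i.+1%:R.
Proof.
have [C [C0 hC]] := mean_centered_sqr_le.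
exists (1 + C); split; first exact: addr_gt0.
move=> i; pose s : R := Num.sqrt i.+1%:R.
have s0 : 0 < s by rewrite sqrtr_gt0.
have s2 : i.+1%:R = s ^+ 2 by rewrite sqr_sqrtr.
(* In place of Cauchy-Schwarz: |y| <= s + y^2/s, where the choice s = sqrt(i+1) balances the two
   means. *)
apply: le_trans (_ : E i (fun g => s + s^-1 * Y i g ^+ 2) <= _).
  apply: le_network_mean => g _.
  rewrite -(ler_pM2l s0) mulrDr mulVKf ?gt_eqF//.
  rewrite -(real_normK (num_real (Y i g))).
  have := sqr_ge0 (s - `|Y i g|); have := normr_ge0 (Y i g).
  by move: `|Y i g| => y; nra.
rewrite network_meanD network_mean_cst// network_meanZ mulrDl mul1r lerD2l.
rewrite mulrC ler_pdivrMr// -mulrA -expr2 -s2.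
exact: hC.
Qed.

End mean_bounds.

(** * The Lindeberg telescoping *)

Lemma ge1_sqrt (R : rcfType) (x : R) : 1 <= x -> 1 <= Num.sqrt x.
Proof. by move=> x1; rewrite -[1]sqrtr1 ler_wsqrtr. Qed.

(* Telescopes to a bound [4 n^(1/4)] on harmonic sums, which is [o(sqrt n)]. *)
Lemma harmonic_increment_le (R : realType) (j : nat) :
  (j.+1%:R)^-1 <= 4 * (Num.sqrt (Num.sqrt j.+1%:R) - Num.sqrt (Num.sqrt j%:R)) :> R.
Proof.
set u := Num.sqrt (Num.sqrt j.+1%:R); set v := Num.sqrt (Num.sqrt j%:R).
have v0 : 0 <= v by exact: sqrtr_ge0.
have u1 : 1 <= u.
  by rewrite !ge1_sqrt// ler1n.
have u4 : u ^+ 4 = j.+1%:R.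
  by rewrite -[4%N]/(2 * 2)%N exprM !sqr_sqrtr// sqrtr_ge0.
have v4 : v ^+ 4 = j%:R.
  by rewrite -[4%N]/(2 * 2)%N exprM !sqr_sqrtr// sqrtr_ge0.
have vu : v <= u by rewrite ler_wsqrtr// ler_wsqrtr// ler_nat.
have u0 : 0 < u by exact: lt_le_trans u1.
have uv : u ^+ 4 - v ^+ 4 = 1 by rewrite u4 v4 -natr1; ring.
rewrite -u4 -[leLHS]mul1r ler_pdivrMr ?exprn_gt0//.
have p1 : v * u ^+ 2 <= u ^+ 3 by rewrite [leRHS]exprS ler_wpM2r ?sqr_ge0.
have p2 : v ^+ 2 * u <= u ^+ 3.
  by rewrite [leRHS]exprSr ler_wpM2r ?(ltW u0)// lerXn2r ?nnegrE ?(ltW u0).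
have p3 : v ^+ 3 <= u ^+ 3 by rewrite lerXn2r ?nnegrE ?(ltW u0).
have p4 : u ^+ 3 <= u ^+ 4 by rewrite [leRHS]exprSr ler_peMr// exprn_ge0// ltW.
rewrite -[leLHS]uv.
have -> : u ^+ 4 - v ^+ 4 = (u - v) * (u ^+ 3 + v * u ^+ 2 + v ^+ 2 * u + v ^+ 3) by ring.
rewrite [leRHS](_ : _ = (u - v) * (4 * u ^+ 4)); last by ring.
rewrite ler_wpM2l ?subr_ge0//; lra.
Qed.

Section smoothed.
Variables (R : realType) (m0 m : nat).
Hypotheses (m_gt0 : (0 < m)%N) (m_le : (m <= m0)%N).

Local Notation M := (m%:R : R).
Local Notation mom k g := (degree_moment R k _ g).
Local Notation Y := (centered_zagreb R m0 m).
Local Notation eta := (zagreb_increment R m0 m).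
Local Notation E := (network_mean R m0 m).
Local Notation Phi := (std_cdf R).

Definition zagreb_scale (n : nat) : R :=
  2 * M * Num.sqrt (m + 1)%:R * Num.sqrt n%:R.

Local Notation s n := (zagreb_scale n).

Lemma zagreb_scale_sqr (n : nat) : s n ^+ 2 = 4 * M ^+ 2 * (M + 1) * n%:R.
Proof. by rewrite /zagreb_scale !exprMn !sqr_sqrtr// natrD; ring. Qed.

Lemma sqrt_le_zagreb_scale (n : nat) : Num.sqrt n%:R <= s n.
Proof.
rewrite /zagreb_scale ler_peMl ?sqrtr_ge0//.
have M1 : 1 <= M by rewrite ler1n.
have : 1 <= Num.sqrt (m + 1)%:R :> R.
  by rewrite ge1_sqrt// ler1n addn1.
by set q := Num.sqrt _; nra.
Qed.

Lemma normalized_zagrebE (i : nat) (g : sgraph (i + m0)) :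
  normalized_zagreb R m i.+1 g = Y i g / s i.+1.
Proof.
by rewrite /normalized_zagreb zagrebE /centered_zagreb natrD natrM natrX.
Qed.

Let m_le_size i : (m <= i + m0)%N. Proof. exact/(leq_trans m_le)/leq_addl. Qed.

(** The variance in the test function is [e] plus 1/n for each step still to come. With k = i + 1,
    the errors are 1/(k sqrt n) for the drift, sqrt k/(k n) for the variance, n^(-3/2) for the third
    moments and n^(-2) for the heat step. *)
Lemma lindeberg_step (e : R) : 0 < e -> exists C : R, 0 < C /\
  forall (a : R) (n i : nat), (i.+1 < n)%N ->
  `|E i.+1 (fun g => Phi ((a - Y i.+1 g / s n) / Num.sqrt (e + (n%:R - i.+2%:R) / n%:R)))
    - E i (fun g => Phi ((a - Y i g / s n) / Num.sqrt (e + (n%:R - i.+1%:R) / n%:R)))|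
  <= C / (Num.sqrt n%:R * i.+1%:R).
Proof.
move=> e0.
have [C0 [C00 heat]] := std_cdf_heat_step R e e0.
have [C1 [C10 h1]] := mean_zagreb_increment R m0 m m_gt0 m_le.
have [C2 [C20 h2]] := mean_zagreb_increment_sqr R m0 m m_gt0 m_le.
have [C3 [C30 h3]] := mean_zagreb_increment_cube R m0 m m_gt0 m_le.
have [C4 [C40 h4]] := mean_centered_abs_le R m0 m m_gt0 m_le.
have [C5 [C50 h5]] := mean_degree_cube_le R m0 m m_gt0 m_le.
exists (C0 * (C1 + C2 * (1 + C4) + C3 * (1 + C5) + 1)); split.
  by rewrite mulr_gt0// !addr_gt0// mulr_gt0// addr_gt0.
move=> a n i ni.
have n0 : 0 < n%:R :> R by rewrite ltr0n; exact: leq_ltn_trans ni.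
pose nu : R := Num.sqrt n%:R; pose ka : R := Num.sqrt i.+1%:R.
have nu2 : n%:R = nu ^+ 2 by rewrite sqr_sqrtr// ltW.
have ka2 : i.+1%:R = ka ^+ 2 by rewrite sqr_sqrtr.
have ka1 : 1 <= ka by rewrite ge1_sqrt// ler1n.
have kanu : ka <= nu by rewrite ler_wsqrtr// ler_nat ltnW.
have ka0 : 0 < ka by exact: lt_le_trans ka1.
have nu0 : 0 < nu by exact: lt_le_trans kanu.
have snu : nu <= s n by exact: sqrt_le_zagreb_scale.
have s0 : 0 < s n by exact: lt_le_trans snu.
pose h : R := n%:R^-1; pose r : R := e + (n%:R - i.+1%:R) / n%:R.
have rh : e + (n%:R - i.+2%:R) / n%:R = r - h.
  by rewrite /r /h -[i.+2%:R]natr1; ring.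
have h0 : 0 <= h by rewrite invr_ge0 ltW.
have er : e <= r - h by rewrite -rh lerDl divr_ge0 ?subr_ge0 ?ler_nat// ltW.
rewrite rh -/r /=.
pose t : R := (s n)^-1.
have t0 : 0 < t by rewrite invr_gt0.
pose bound (g : sgraph (i + m0)) : R :=
  C0 * (C1 / ka ^+ 2 * t + C2 / ka ^+ 2 * t ^+ 2 * (1 + `|Y i g|)
    + (C3 * t ^+ 3 * (1 + mom 3 g / ka ^+ 2) + h ^+ 2)).
apply: le_trans (_ : E i bound <= _).
  rewrite -network_meanB.
  apply: le_trans (ler_norm_network_mean _ _ _ _ _) _.
  apply: le_network_mean => g gt.
  set x := a - Y i g / s n.
  have [g1 [g2 [g1C g2C hw]]] := heat r h x h0 er.
  (* The remainder in [std_cdf_heat_step] for the displacement w = -eta/s_n; the sign is there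
     because [Y] is subtracted from [a]. *)
  pose D (A : nodeset (i + m0)) := Phi ((x + - (eta i g A * t)) / Num.sqrt (r - h))
    - Phi (x / Num.sqrt r) - g1 * - (eta i g A * t) - g2 * ((- (eta i g A * t)) ^+ 2 - h).
  have -> : subset_mean R (i + m0) m
      (fun A => Phi ((a - Y i.+1 (attach g A) / s n) / Num.sqrt (r - h))) =
    subset_mean R _ m D + Phi (x / Num.sqrt r)
      - g1 * t * subset_mean R _ m (eta i g)
      + g2 * (t ^+ 2 * subset_mean R _ m (fun A => eta i g A ^+ 2) - h).
    transitivity (subset_mean R _ m D + (Phi (x / Num.sqrt r) - g2 * h)
      + (- (g1 * t)) * subset_mean R _ m (eta i g)
      + (g2 * t ^+ 2) * subset_mean R _ m (fun A => eta i g A ^+ 2)); last by ring.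
    rewrite -{1}(subset_mean_cst R (i + m0) m (Phi (x / Num.sqrt r) - g2 * h) (m_le_size i)).
    rewrite -!subset_meanZ -!subset_meanD; apply: eq_subset_mean => A Am.
    rewrite centered_zagreb_attach// (_ : a - _ = x + - (eta i g A * t)); last first.
      by rewrite /x /t; ring.
    by rewrite /D; ring.
  set e1 := subset_mean R _ m (eta i g); set e2 := subset_mean R _ m (fun A => _ ^+ 2).
  (* The normalization enters here: the variance 1/n removed per step is exactly the limiting
     conditional variance of the scaled increment, so only its deviation remains next to [g2]. *)
  have th : h = t ^+ 2 * (4 * M ^+ 2 * (M + 1)).
    rewrite /t exprVn zagreb_scale_sqr /h.
    have M0 : M != 0 by rewrite pnatr_eq0 -lt0n.
    have M1 : M + 1 != 0 by rewrite natr1 pnatr_eq0.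
    by move: (lt0r_neq0 n0); move: (n%:R : R) => n' n'0; field; rewrite n'0 M1.
  have -> : subset_mean R (i + m0) m D + Phi (x / Num.sqrt r) - g1 * t * e1 +
    g2 * (t ^+ 2 * e2 - h) - Phi (x / Num.sqrt r) =
    g1 * (- (e1 * t)) + g2 * ((e2 - 4 * M ^+ 2 * (M + 1)) * t ^+ 2)
    + subset_mean R (i + m0) m D by rewrite th; ring.
  have -> : bound g = C0 * (C1 / ka ^+ 2 * t) +
    C0 * (C2 * (1 + `|Y i g|) / ka ^+ 2 * t ^+ 2) +
    C0 * (C3 * t ^+ 3 * (1 + mom 3 g / ka ^+ 2) + h ^+ 2) by rewrite /bound; ring.
  apply: ler_normD_le; first apply: ler_normD_le.
  - apply: ler_normM_le => //; rewrite normrN -ka2; apply: ler_normM_le.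
      exact: h1.
    by rewrite ger0_norm// ltW.
  - apply: ler_normM_le => //; rewrite -ka2; apply: ler_normM_le.
      exact: h2.
    by rewrite ger0_norm// exprn_ge0// ltW.
  - apply: le_trans (ler_norm_subset_mean _ _ _ _) _.
    apply: le_trans (_ : subset_mean R _ m (fun A =>
      C0 * h ^+ 2 + C0 * t ^+ 3 * `|eta i g A| ^+ 3) <= _).
      apply: le_subset_mean => A _; apply: le_trans (hw _) _.
      rewrite normrN normrM (gtr0_norm t0) exprMn.
      by rewrite le_eqVlt; apply/orP; left; apply/eqP; ring.
    rewrite subset_meanD subset_mean_cst// subset_meanZ addrC [leRHS]mulrDr lerD2r.
    rewrite [leRHS](_ : _ = C0 * t ^+ 3 * (C3 * (1 + mom 3 g / i.+1%:R))); last first.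
      by rewrite ka2; ring.
    by rewrite ler_wpM2l ?mulr_ge0 ?exprn_ge0 ?(ltW C00) ?(ltW t0)//; exact: h3.
rewrite /bound network_meanZ -[leRHS]mulrA ler_pM2l//.
rewrite network_meanD network_meanD network_meanD !network_mean_cst//.
rewrite !network_meanZ !network_meanD !network_mean_cst//.
have -> : E i (fun g => mom 3 g / ka ^+ 2) = (ka ^+ 2)^-1 * E i (fun g => mom 3 g).
  by rewrite -network_meanZ; apply: eq_network_mean => g _; rewrite mulrC.
have E5 : (ka ^+ 2)^-1 * E i (fun g => mom 3 g) <= C5.
  by rewrite mulrC ler_pdivrMr ?exprn_gt0// -ka2; exact: h5.
have E4 : 1 + E i (fun g => `|Y i g|) <= (1 + C4) * ka.
  by rewrite mulrDl mul1r; apply: lerD => //; exact: h4.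
(* All four errors are compared with [z], by means of 1 <= ka <= nu and t <= 1/nu. *)
pose z : R := (nu * ka ^+ 2)^-1.
have z0 : 0 < z by rewrite invr_gt0 mulr_gt0// exprn_gt0.
have zE : z = nu^-1 * (ka ^+ 2)^-1 by exact: invfM.
have tnu : t <= nu^-1 by rewrite lef_pV2.
have nui : 0 < nu^-1 by rewrite invr_gt0.
have kai : 0 < ka^-1 by rewrite invr_gt0.
have B1 : C1 / ka ^+ 2 * t <= C1 * z.
  rewrite -[leLHS]mulrA ler_pM2l// zE [leLHS]mulrC ler_wpM2r// invr_ge0 exprn_ge0//.
  exact: ltW.
have nuka : nu^-1 <= ka^-1 by rewrite lef_pV2.
have tk2 : t ^+ 2 <= nu^-1 * ka^-1.
  by rewrite expr2; apply: ler_pM => //; [exact: ltW|exact: ltW|exact: le_trans nuka].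
have tk3 : t ^+ 3 <= z.
  rewrite exprS zE -exprVn; apply: ler_pM => //; first exact: ltW.
    by rewrite exprn_ge0// ltW.
  by rewrite lerXn2r ?nnegrE ?(ltW t0) ?(ltW kai)//; exact: le_trans nuka.
have B2 : C2 / ka ^+ 2 * t ^+ 2 * (1 + E i (fun g => `|Y i g|)) <= C2 * (1 + C4) * z.
  apply: le_trans (_ : C2 / ka ^+ 2 * (nu^-1 * ka^-1) * ((1 + C4) * ka) <= _).
    apply: ler_pM => //.
    - by rewrite mulr_ge0 ?exprn_ge0 ?divr_ge0 ?exprn_ge0 ?(ltW t0) ?(ltW C20) ?(ltW ka0).
    - rewrite addr_ge0// -[leLHS](network_mean_cst R m0 m i 0 m_le).
      by apply: le_network_mean => g _.
    - by rewrite ler_wpM2l// divr_ge0 ?exprn_ge0 ?(ltW C20) ?(ltW ka0).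
  rewrite le_eqVlt; apply/orP; left; apply/eqP; rewrite /z; field.
  by rewrite !gt_eqF.
have B3 : C3 * t ^+ 3 * (1 + (ka ^+ 2)^-1 * E i (fun g => mom 3 g)) <= C3 * (1 + C5) * z.
  rewrite mulrAC; apply: ler_pM => //.
  - rewrite mulr_ge0 ?(ltW C30)// addr_ge0// mulr_ge0 ?invr_ge0 ?exprn_ge0 ?(ltW ka0)//.
    rewrite -[leLHS](network_mean_cst R m0 m i 0 m_le).
    by apply: le_network_mean => g _; apply: sumr_ge0 => v _; rewrite exprn_ge0.
  - by rewrite exprn_ge0// ltW.
  - by rewrite ler_pM2l// lerD2l.
have B4 : h ^+ 2 <= z.
  rewrite /h nu2 -exprVn -exprM zE [nu^-1 ^+ _]exprS -exprVn.
  rewrite ler_pM2l// -[leRHS]mul1r [leLHS]exprS; apply: ler_pM => //.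
  - exact: ltW.
  - by rewrite exprn_ge0// ltW.
  - by rewrite invf_le1// (le_trans ka1).
  - by rewrite lerXn2r ?nnegrE ?(ltW nui) ?(ltW kai).
rewrite ka2 -/nu -/z !mulrDl mul1r; lra.
Qed.

End smoothed.

(** * The limit of the smoothed mean, and removal of the smoothing *)

Section smoothed_limit.
Variables (R : realType) (m0 m : nat).
Hypotheses (m_gt0 : (0 < m)%N) (m_le : (m <= m0)%N).

Local Notation M := (m%:R : R).
Local Notation Y := (centered_zagreb R m0 m).
Local Notation E := (network_mean R m0 m).
Local Notation Phi := (std_cdf R).
Local Notation s n := (zagreb_scale R m n).

(** The steps telescope, and [harmonic_increment_le] sums their costs. At the final index j = n - 1
    the bound is O(n^(-1/4)). *)
Lemma lindeberg_bound (e : R) : 0 < e -> exists C : R, 0 < C /\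
  forall (a : R) (n j : nat), (j < n)%N ->
  `|E j (fun g => Phi ((a - Y j g / s n) / Num.sqrt (e + (n%:R - j.+1%:R) / n%:R)))
    - E 0 (fun g => Phi ((a - Y 0 g / s n) / Num.sqrt (e + (n%:R - 1) / n%:R)))|
  <= C * Num.sqrt (Num.sqrt j%:R) / Num.sqrt n%:R.
Proof.
move=> e0; have [C [C0 step]] := lindeberg_step R m0 m m_gt0 m_le e e0.
exists (C * 4); split; first by rewrite mulr_gt0.
move=> a n; elim=> [|j IH] jn.
  by rewrite subrr normr0 sqrtr0 sqrtr0 mulr0 mul0r.
set b := E j.+1 _; set b0 := E 0 _.
pose b1 := E j (fun g => Phi ((a - Y j g / s n) / Num.sqrt (e + (n%:R - j.+1%:R) / n%:R))).
have {}IH : `|b1 - b0| <= _ := IH (ltnW jn).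
have {}step : `|b - b1| <= _ := step a n j jn.
rewrite (_ : b - b0 = (b - b1) + (b1 - b0)); last by ring.
apply: le_trans (ler_normD_le _ _ _ _ _ step IH) _.
rewrite invfM [C * (_ * _)]mulrA [C / _ * _]mulrAC -mulrDl.
rewrite ler_wpM2r ?invr_ge0 ?sqrtr_ge0//.
rewrite -!mulrA -mulrDr ler_pM2l//.
by rewrite -lerBrDr -mulrBr; exact: harmonic_increment_le.
Qed.

Lemma smoothed_zagreb_cvg (e a : R) : 0 < e ->
  E n (fun g => Phi ((a - normalized_zagreb R m n.+1 g) / Num.sqrt e)) @[n --> \oo]
    --> Phi (a / Num.sqrt (e + 1)).
Proof.
move=> e0; have [C [C0 bound]] := lindeberg_bound e e0.
pose y0 := Y 0 (complete_graph m0).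
pose c := 2 * M * Num.sqrt (m + 1)%:R.
(* At u = 1/(n+1) this is the deterministic starting term of the telescoping, so its limit is the
   continuity of [psi] at 0. *)
pose psi (u : R) := Phi ((a - y0 / c * Num.sqrt u) / Num.sqrt (e + (1 - u))).
have psi0 : psi 0 = Phi (a / Num.sqrt (e + 1)).
  by rewrite /psi sqrtr0 mulr0 !subr0.
have psi_cont : {for 0, continuous psi}.
  rewrite /psi; apply: (@continuous_comp _ _ _ _ Phi); last exact: continuous_std_cdf.
  apply: cvgM.
    apply: cvgB; first exact: cvg_cst.
    by apply: cvgM; [exact: cvg_cst|exact: sqrt_continuous].
  apply: cvgV; first by rewrite subr0 gt_eqF// sqrtr_gt0 addr_gt0.
  apply: (@continuous_comp _ _ _ (fun u : R => e + (1 - u))); last exact: sqrt_continuous.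
  apply: cvgD; first exact: cvg_cst.
  by apply: cvgB; [exact: cvg_cst|exact: cvg_id].
rewrite -psi0.
apply: (@cvg_sub0 _ _ _ _ _ _ (fun n => psi (harmonic n))); last first.
  exact: continuous_cvg psi_cont cvg_harmonic.
have root_cvg : C * Num.sqrt (Num.sqrt (harmonic n)) @[n --> \oo] --> (0 : R).
  rewrite -[X in _ --> X](mulr0 C); apply: cvgM; first exact: cvg_cst.
  have -> : (0 : R) = Num.sqrt (Num.sqrt 0) by rewrite !sqrtr0.
  apply: continuous_cvg; first exact: sqrt_continuous.
  by apply: continuous_cvg; [exact: sqrt_continuous|exact: cvg_harmonic].
apply: (@norm_cvg0 _ R).
apply: (squeeze_cvgr _ (cvg_cst 0) root_cvg).
near=> n; rewrite normr_ge0/=.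
have n0 : (0 : R) < n.+1%:R by rewrite ltr0n.
have := bound a n.+1 n (ltnSn n).
(* At the last time no step remains, and the variance in the test function is [e] alone. *)
rewrite subrr mul0r addr0.
under eq_network_mean do rewrite -normalized_zagrebE.
rewrite [E 0 _](_ : _ = psi (harmonic n)); last first.
  rewrite /= /psi /harmonic -/y0.
  rewrite (_ : y0 / s n.+1 = y0 / c * Num.sqrt n.+1%:R^-1); last first.
    by rewrite /zagreb_scale -/c invfM mulrA sqrtrV// ltW.
  rewrite (_ : (n.+1%:R - 1) / n.+1%:R = 1 - n.+1%:R^-1)//.
  by rewrite mulrBl divff ?gt_eqF// mul1r.
move/le_trans; apply.
rewrite -mulrA ler_pM2l//= sqrtrV ?(ltW n0)// sqrtrV ?sqrtr_ge0//.
set v := Num.sqrt (Num.sqrt n.+1%:R).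
have v0 : 0 < v by rewrite !sqrtr_gt0.
have -> : Num.sqrt n.+1%:R = v ^+ 2 :> R by rewrite sqr_sqrtr// sqrtr_ge0.
rewrite ler_pdivrMr ?exprn_gt0// expr2 mulKf ?gt_eqF//.
by rewrite ler_wsqrtr// ler_wsqrtr// ler_nat.
Unshelve. all: by end_near. Qed.

(** The indicator is squeezed between smoothed ones of width [d], shifted by [K * d] to either side.
    [K] is chosen first to make the normal tails small, then [d] to bring both limits near [Phi x],
    then [n]; each choice costs a third of [eps]. *)
Lemma normalized_zagreb_cvg (x : R) :
  E n (fun g => (normalized_zagreb R m n.+1 g <= x)%R%:R) @[n --> \oo] --> Phi x.
Proof.
apply/cvgrPdist_le => eps eps0.
have e30 : 0 < eps / 3 by rewrite divr_gt0.
have [K [K1 K2]] : exists K : R, 1 - Phi K <= eps / 3 /\ Phi (- K) <= eps / 3.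
  have h1 := std_cdf_cvgy R; have h2 := std_cdf_cvgNy R.
  move/cvgrPdist_le/(_ _ e30) : h1 => h1.
  have {}h2 : \forall K \near +oo, `|0 - Phi (- K)| <= eps / 3.
    move/cvgrPdist_le/(_ _ e30) : h2 => [N [Nr h2]].
    exists (- N); split; first by rewrite realN.
    by move=> z; rewrite ltrNl => /h2.
  near (pinfty_nbhs R) => K.
  exists K; split.
    have : `|1 - Phi K| <= eps / 3 by near: K.
    by move=> /ler_normlP[].
  have : `|0 - Phi (- K)| <= eps / 3 by near: K.
  by rewrite sub0r normrN => /ler_normlP[].
have Phi_cont k : Phi ((x + k * d) / Num.sqrt (d ^+ 2 + 1)) @[d --> 0] --> Phi x.
  pose chi d := Phi ((x + k * d) / Num.sqrt (d ^+ 2 + 1)).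
  have <- : chi 0 = Phi x.
    by rewrite /chi mulr0 addr0 expr0n/= add0r sqrtr1 divr1.
  suff : {for 0, continuous chi} by [].
  rewrite /chi; apply: (@continuous_comp _ _ _ _ Phi); last exact: continuous_std_cdf.
  apply: cvgM.
    by apply: cvgD; [exact: cvg_cst|apply: cvgM; [exact: cvg_cst|exact: cvg_id]].
  apply: cvgV; first by rewrite expr0n/= add0r sqrtr1 oner_eq0.
  apply: (@continuous_comp _ _ _ (fun d : R => d ^+ 2 + 1)); last exact: sqrt_continuous.
  by apply: cvgD; [exact: exprn_continuous|exact: cvg_cst].
have [d [d0 dU dL]] : exists d : R, [/\ 0 < d,
    `|Phi x - Phi ((x + K * d) / Num.sqrt (d ^+ 2 + 1))| <= eps / 3 &
    `|Phi x - Phi ((x + (- K) * d) / Num.sqrt (d ^+ 2 + 1))| <= eps / 3].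
  have /cvgrPdist_le/(_ _ e30) h1 := cvg_at_right_filter (Phi_cont K).
  have /cvgrPdist_le/(_ _ e30) h2 := cvg_at_right_filter (Phi_cont (- K)).
  near (0 : R)^'+ => d.
  by exists d; split => //; near: d.
have d2 : 0 < d ^+ 2 by rewrite exprn_gt0.
have sd : Num.sqrt (d ^+ 2) = d by rewrite sqrtr_sqr gtr0_norm.
have /cvgrPdist_le/(_ _ e30) hU := smoothed_zagreb_cvg (d ^+ 2) (x + K * d) d2.
have /cvgrPdist_le/(_ _ e30) hL := smoothed_zagreb_cvg (d ^+ 2) (x + - K * d) d2.
near=> n.
have hUn : `|Phi ((x + K * d) / Num.sqrt (d ^+ 2 + 1)) - E n (fun g =>
  Phi ((x + K * d - normalized_zagreb R m n.+1 g) / Num.sqrt (d ^+ 2)))| <= eps / 3.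
  by near: n.
have hLn : `|Phi ((x + - K * d) / Num.sqrt (d ^+ 2 + 1)) - E n (fun g =>
  Phi ((x + - K * d - normalized_zagreb R m n.+1 g) / Num.sqrt (d ^+ 2)))| <= eps / 3.
  by near: n.
rewrite sd in hUn hLn.
(* For X <= x the argument (x + K d - X)/d is at least [K], so the smoothed indicator misses 1 by at
   most 1 - Phi K. The lower bound is symmetric. *)
have upper : E n (fun g => (normalized_zagreb R m n.+1 g <= x)%R%:R) <= E n (fun g =>
  Phi ((x + K * d - normalized_zagreb R m n.+1 g) / d)) + (1 - Phi K).
  rewrite -[X in _ <= _ + X](network_mean_cst R m0 m n _ m_le) -network_meanD.
  apply: le_network_mean => g _; set X := normalized_zagreb _ _ _ _.
  have [Xx|_] /= := leP X x; last by rewrite addr_ge0 ?std_cdf_ge0// subr_ge0 std_cdf_le1.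
  rewrite addrCA lerDl subr_ge0; apply: std_cdf_nondecreasing.
  by rewrite ler_pdivlMr//; lra.
have lower : E n (fun g => Phi ((x + - K * d - normalized_zagreb R m n.+1 g) / d)) <=
  E n (fun g => (normalized_zagreb R m n.+1 g <= x)%R%:R) + Phi (- K).
  rewrite -[X in _ <= _ + X](network_mean_cst R m0 m n _ m_le) -network_meanD.
  apply: le_network_mean => g _; set X := normalized_zagreb _ _ _ _.
  have [_|xX] /= := leP X x.
    by apply: le_trans (std_cdf_le1 _ _) _; rewrite lerDl std_cdf_ge0.
  rewrite add0r; apply: std_cdf_nondecreasing.
  by rewrite ler_pdivrMr//; lra.
move: hUn hLn => /ler_normlP[? ?] /ler_normlP[? ?].
move: dU dL => /ler_normlP[? ?] /ler_normlP[? ?].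
apply/ler_normlP; split; lra.
Unshelve. all: by end_near. Qed.

End smoothed_limit.

Theorem theorem1 (R : realType) (d : measure_display) (T : measurableType d)
    (P : probability T R) (m0 m : nat)
    (U : forall n, {RV P >-> sgraph (n.-1 + m0)})
    (V : forall n, {RV P >-> nodeset (n.-2 + m0)}) :
  (1 <= m0)%N -> (1 <= m <= m0)%N ->
  random_network m U V ->
  cvg_in_distribution
    (fun n => (@normalized_zagreb R m n (n.-1 + m0) \o U n : {RV P >-> R}))
    (normal_prob 0 1).
Proof.
move=> _ /andP[m_gt0 m_le] UV x _.
set X := (fun n => (normalized_zagreb R m n (N:=n.-1 + m0) \o U n : {RV P >-> R})).
apply: (@eq_ind _ (std_cdf R x)%:E (fun l => cdf (X n) x @[n --> \oo] --> l)); last first.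
  by rewrite /std_cdf fineK ?fin_num_measure.
(* The shift drops the meaningless time 0 and matches index [n] of [network_mean] with time
   [n.+1]. *)
rewrite -(cvg_shiftS (fun n => cdf (X n) x)) /=.
have cdfE n : cdf (X n.+1) x =
    (network_mean R m0 m n (fun g => (normalized_zagreb R m n.+1 g <= x)%R%:R))%:E.
  rewrite -(@law_network_mean _ _ _ P m0 m U V UV n
    (fun g => normalized_zagreb R m n.+1 g <= x)).
  rewrite /cdf /distribution /pushforward; exact: (congr1 P).
under eq_fun do rewrite cdfE.
apply: cvg_EFin; first by near=> n.
exact: normalized_zagreb_cvg.
Unshelve. all: by end_near. Qed.
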